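(* Let $\tau:E\to M$ be an affine bundle modelled on a vector bundle $V\to M$ and equipped with a Lie algebroid structure, with bidual $\tilde E$, and let $\mu:P\to M$ be a fibre bundle. Let $\boldsymbol{I}:\mathcal{L}^VP\to\mathcal{L}^{\tilde E}P$ and $J:\mathcal{L}^{\tilde E}P\to P\times\mathbb{R}$ be the maps $$\boldsymbol{I}(\boldsymbol{v},W)=(\boldsymbol{i}(\boldsymbol{v}),W)\qquad\text{and}\qquad J(z,W)=(\mu_1(z,W),j_m(z)),$$ where $m\in M$ is the base point of $z\in\tilde E_m$. Then the following sequence of vector bundles over $P$ is exact: $$0\longrightarrow\mathcal{L}^VP\xrightarrow{\ \boldsymbol{I}\ }\mathcal{L}^{\tilde E}P\xrightarrow{\ J\ }P\times\mathbb{R}\longrightarrow0.$$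
   Context: All bundles are smooth and affine/vector bundles have finite rank. For $m\in M$, $E_m^\dagger=\mathrm{Aff}(E_m,\mathbb{R})$; these form the vector bundle $E^\dagger\to M$, and $\tilde E=(E^\dagger)^*$. For $\varphi\in E^\dagger_m$ let $\boldsymbol{\varphi}\in V_m^*$ be its linear part. Canonical maps: $i:E\to\tilde E$, $i(a)(\varphi)=\varphi(a)$; its linear part $\boldsymbol{i}:V\to\tilde E$, $\boldsymbol{i}(\boldsymbol{v})(\varphi)=\boldsymbol{\varphi}(\boldsymbol{v})$; and $j_m:\tilde E_m\to\mathbb{R}$, $j_m(z)=\langle z,1\rangle$ (pairing with the constant function $1$ on $E_m$). A Lie algebroid structure on the affine bundle $E$ is equivalent to a vector Lie algebroid structure $([\,,\,],\tilde\rho)$ on $\tilde E$ such that the bracket of two sections in the image of $i$ lies in the image of $\boldsymbol{i}$. Then $V$ is also a Lie algebroid, with $\boldsymbol{i}([\boldsymbol{\eta}_1,\boldsymbol{\eta}_2])=[\boldsymbol{i}(\boldsymbol{\eta}_1),\boldsymbol{i}(\boldsymbol{\eta}_2)]$ and anchor $\boldsymbol{\rho}=\tilde\rho\circ\boldsymbol{i}$. Prolongation: for a vector Lie algebroid $F\to M$ with anchor $\rho_F$ and a fibre bundle $\mu:P\to M$, set $$\mathcal{L}^FP=\{(z,W)\in F\times TP\mid \rho_F(z)=T\mu(W)\},$$ regarded as a vector bundle over $P$ with projection $\mu_1:\mathcal{L}^FP\to P$, $\mu_1(z,W)=\tau_P(W)$, where $\tau_P:TP\to P$ is the tangent bundle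 projection. (So if $\mu_1(z,W)=p$, then $z\in F_{\mu(p)}$.) This is used for $F=V$ (anchor $\boldsymbol{\rho}$) and $F=\tilde E$ (anchor $\tilde\rho$). *)

(* Defs.v *)
From HB Require Import structures.
From mathcomp Require Import all_boot all_order all_algebra.
From mathcomp Require Import all_classical all_reals all_analysis.
Set Implicit Arguments.
Unset Strict Implicit.
Unset Printing Implicit Defensive.
Import Order.TTheory GRing.Theory Num.Theory numFieldNormedType.Exports.
Local Open Scope classical_set_scope.
Local Open Scope ring_scope.

Section Submodules.
Variables (R : realType) (U : lmodType R).

Record submodule := Submodule {
  sm_set : U -> Prop;
  sm0 : sm_set 0;
  smZD : forall a u v, sm_set u -> sm_set v -> sm_set (a *: u + v) }.

Definition sm_pred (S : submodule) : {pred U} := [pred x | `[< sm_set S x >]].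

Lemma sm_pred_closed (S : submodule) : GRing.submod_closed (sm_pred S).
Proof.
split; first exact/asboolP/sm0.
by move=> a u v /asboolP Su /asboolP Sv; apply/asboolP/smZD.
Qed.

HB.instance Definition _ (S : submodule) :=
  GRing.isSubmodClosed.Build R U (sm_pred S) (sm_pred_closed S).

Record sm_type (S : submodule) := SmType { sm_val : U; _ : sm_val \in sm_pred S }.

HB.instance Definition _ (S : submodule) := [isSub for @sm_val S].
HB.instance Definition _ (S : submodule) := [Choice of sm_type S by <:].
HB.instance Definition _ (S : submodule) :=
  [SubChoice_isSubLmodule of sm_type S by <:].

End Submodules.

Definition mk_sub (R : realType) (U : lmodType R) (S : submodule U) (u : U)
    (Su : sm_set S u) : sm_type S :=
  SmType (introT (asboolP (sm_set S u)) Su).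

Lemma sm_valP (R : realType) (U : lmodType R) (S : submodule U) (u : sm_type S) :
  sm_set S (\val u).
Proof. by case: u => u /= /asboolP. Qed.

Lemma sm_valZD (R : realType) (U : lmodType R) (S : submodule U) c
    (u v : sm_type S) : \val (c *: u + v) = c *: \val u + \val v.
Proof. exact: linearP. Qed.

Lemma fctZD (R : realType) (T : Type) (c : R) (f g : T -> R^o) (x : T) :
  (c *: f + g) x = c * (f x : R) + g x.
Proof. by []. Qed.

Section Smoothness.
Variable R : realType.

Fixpoint Ck (k n : nat) (A : set 'rV[R]_n) (f : 'rV[R]_n -> R) : Prop :=
  if k is k'.+1 then
    (forall x, A x -> differentiable f x) /\
    (forall v, Ck k' A (fun x => 'D_v f x))
  else forall x, A x -> {for x, continuous f}.

(* Meaningful for open A only; all the sets it is applied to are open. *)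
Definition smooth_on (n : nat) (A : set 'rV[R]_n) (f : 'rV[R]_n -> R) : Prop :=
  forall k, Ck k A f.

Lemma smooth_on_cst (n : nat) (A : set 'rV[R]_n) (c : R) :
  smooth_on A (fun=> c).
Proof.
move=> k; elim: k c => [|k IHk] c /=; first by move=> x _; exact: cst_continuous.
split=> [x _|v]; first exact: differentiable_cst.
by under eq_fun do rewrite derive_cst; exact: IHk.
Qed.

End Smoothness.

Section Manifolds.
Variable R : realType.

(* [cmap] is only meaningful on [cdom], and [cinv] only on its image. *)
Record chart (T : Type) (n : nat) := Chart {
  cdom : set T;
  cmap :> T -> 'rV[R]_n;
  cinv : 'rV[R]_n -> T }.

Definition is_chart (T : topologicalType) (n : nat) (c : chart T n) : Prop :=
  [/\ open (cdom c), open (c @` cdom c),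
      forall p, cdom c p -> cinv c (c p) = p,
      forall p, cdom c p -> {for p, continuous c} &
      forall x, (c @` cdom c) x -> {for x, continuous (cinv c)}].

Record premanifold (n : nat) := Premanifold {
  space :> topologicalType;
  atlas : set (chart space n) }.

Arguments atlas {n} p _.

Definition is_manifold (n : nat) (M : premanifold n) : Prop :=
  [/\ hausdorff_space M /\ @second_countable M,
      forall c, atlas M c -> is_chart c,
      forall p : M, exists c, atlas M c /\ cdom c p &
      forall c d, atlas M c -> atlas M d -> forall j,
        smooth_on (c @` (cdom c `&` cdom d)) (fun x => d (cinv c x) ord0 j)].

Record manifold (n : nat) := Manifold {
  premanifold_of :> premanifold n;
  manifoldP : is_manifold premanifold_of }.

Definition prod_chart (T T' : Type) (n n' : nat) (c : chart T n)
    (c' : chart T' n') : chart (T * T') (n + n') :=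
  Chart (cdom c `*` cdom c') (fun p => row_mx (c p.1) (c' p.2))
        (fun x => (cinv c (lsubmx x), cinv c' (rsubmx x))).

Definition prod_manifold (n n' : nat) (M : premanifold n) (N : premanifold n') :
    premanifold (n + n') :=
  @Premanifold _ (M * N)%type
    [set e | exists c c', [/\ atlas M c, atlas N c' & e = prod_chart c c']].

(* Smoothness on an open set U of a function that is total, but whose values
   outside U are irrelevant. *)
Definition smooth_fun (n : nat) (M : premanifold n) (U : set M) (f : M -> R) :=
  forall c, atlas M c -> smooth_on (c @` (cdom c `&` U)) (fun x => f (cinv c x)).

Definition smooth_mx (n a b : nat) (M : premanifold n) (U : set M)
    (g : M -> 'M[R]_(a, b)) :=
  forall i j, smooth_fun U (fun p => g p i j).

Definition smooth_map (n n' : nat) (M : premanifold n) (N : premanifold n')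
    (U : set M) (f : M -> N) :=
  (forall p, U p -> {for p, continuous f}) /\
  forall c d, atlas M c -> atlas N d -> forall j,
    smooth_on (c @` (cdom c `&` U `&` f @^-1` cdom d))
              (fun x => d (f (cinv c x)) ord0 j).

Lemma chart_exists (n : nat) (M : manifold n) (p : M) :
  exists c, atlas M c /\ cdom c p.
Proof. by have [_ _ + _] := manifoldP M; apply. Qed.

Definition chart_at (n : nat) (M : manifold n) (p : M) : chart M n :=
  projT1 (cid (chart_exists p)).

(* A tangent vector at p is given by its components in the chart chosen at p;
   [tangent_triv] below gives its components in any other chart. *)
Definition tangent (n : nat) (M : manifold n) (p : M) : lmodType R := 'rV[R]_n.

Definition tangent_map (n n' : nat) (M : manifold n) (N : manifold n')
    (f : M -> N) (p : M) : {linear tangent p -> tangent (f p)} :=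
  mulmxr ('J (fun x => chart_at (f p) (f (cinv (chart_at p) x)))
             (chart_at p p)).

Definition tangent_der (n : nat) (M : manifold n) (p : M) (w : tangent p)
    (f : M -> R) : R :=
  'D_w (fun x => f (cinv (chart_at p) x)) (chart_at p p).

End Manifolds.

Arguments atlas {R n} p _.

Section VectorBundles.
Variables (R : realType) (n : nat) (M : manifold R n).

(* [tcoord] is defined on all the fibres, but only meaningful over [tdom]. *)
Record trivialization (F : M -> lmodType R) (k : nat) := Triv {
  tdom : set M;
  tcoord : forall p, {linear F p -> 'rV[R]_k} }.

(* A fibre bundle of vector spaces is presented by its fibres and local
   trivializations, which determine the manifold structure of its total space. *)
Record prebundle (k : nat) := Prebundle {
  fib :> M -> lmodType R;
  trivs : set (trivialization fib k) }.

Arguments trivs {k} p _.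

(* The matrix of Phi with respect to s and t is smooth. *)
Definition smooth_matrix (F G : M -> lmodType R) (k l : nat)
    (Phi : forall p, {linear F p -> G p})
    (s : trivialization F k) (t : trivialization G l) : Prop :=
  exists g : M -> 'M[R]_(k, l), smooth_mx (tdom s `&` tdom t) g /\
    forall p, tdom s p -> tdom t p -> forall u,
      tcoord t p (Phi p u) = tcoord s p u *m g p.

Definition is_vector_bundle (k : nat) (B : prebundle k) : Prop :=
  [/\ forall t, trivs B t -> open (tdom t),
      forall t, trivs B t -> forall p, tdom t p -> bijective (tcoord t p),
      forall p, exists t, trivs B t /\ tdom t p &
      forall s t, trivs B s -> trivs B t -> smooth_matrix (fun p => idfun) s t].

Record vector_bundle (k : nat) := VectorBundle {
  prebundle_of :> prebundle k;
  vector_bundleP : is_vector_bundle prebundle_of }.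

(* Vector bundle morphisms over the identity of M. *)
Definition smooth_hom (k l : nat) (A : prebundle k) (B : prebundle l)
    (Phi : forall p, {linear A p -> B p}) : Prop :=
  forall s t, trivs A s -> trivs B t -> smooth_matrix Phi s t.

Definition smooth_section (k : nat) (B : prebundle k) (s : forall p, B p) : Prop :=
  forall t, trivs B t -> smooth_mx (tdom t) (fun p => tcoord t p (s p)).

Definition short_exact (a b c : nat) (A : prebundle a) (B : prebundle b)
    (C : prebundle c) (Phi : forall p, {linear A p -> B p})
    (Psi : forall p, {linear B p -> C p}) : Prop :=
  [/\ [/\ is_vector_bundle A, is_vector_bundle B & is_vector_bundle C],
      smooth_hom Phi, smooth_hom Psi &
      forall p, [/\ forall u, Phi p u = 0 -> u = 0,
                    forall v, Psi p v = 0 <-> exists u, Phi p u = v &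
                    forall w, exists v, Psi p v = w]].

Definition tangent_triv (c : chart R M n) :
    trivialization (@tangent R n M) n :=
  @Triv (@tangent R n M) n (cdom c) (fun p =>
    mulmxr ('J (fun x => c (cinv (chart_at p) x)) (chart_at p p))).

Definition tangent_bundle : prebundle n :=
  Prebundle [set t | exists2 c, atlas M c & t = tangent_triv c].

Definition line_coord (p : M) (x : R^o) : 'rV[R]_1 := x%:M.

Lemma line_coord_linear p : linear (line_coord p).
Proof. by move=> a x y; rewrite /line_coord raddfD /= scale_scalar_mx. Qed.

HB.instance Definition _ p :=
  GRing.isLinear.Build R R^o 'rV[R]_1 _ (line_coord p) (line_coord_linear p).

(* M x R *)
Definition trivial_line_bundle : prebundle 1 :=
  @Prebundle 1 (fun=> R^o) [set Triv setT (fun p => line_coord p)].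

End VectorBundles.

Arguments trivs {R n M k} p _.

Section AffineSpaces.
Variable R : realType.

Record affine_space (V : lmodType R) := AffineSpace {
  point :> Type;
  trans : point -> V -> point;
  trans0 : forall a, trans a 0 = a;
  transD : forall a u v, trans (trans a u) v = trans a (u + v);
  trans_free_transitive : forall a b, exists! v, trans a v = b;
  point_inhabited : inhabited point }.

Section AffineDual.
Variable (V : lmodType R) (E : affine_space V).

Definition is_affine (phi : E -> R^o) : Prop :=
  exists l : {linear V -> R^o}, forall a v, phi (trans a v) = phi a + l v.

Lemma is_affine0 : is_affine 0.
Proof. by exists \0 => a v /=; rewrite addr0. Qed.

Lemma is_affineZD c f g : is_affine f -> is_affine g -> is_affine (c *: f + g).
Proof.
move=> [l fl] [l' gl'].
exists ((c \*: l) \+ l') => a v /=.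
by rewrite !fctZD fl gl' mulrDr addrACA.
Qed.

(* Aff(E, R) *)
Definition aff_dual : lmodType R :=
  sm_type (Submodule is_affine0 is_affineZD).

Lemma aff_dual_affine (phi : aff_dual) : is_affine (\val phi).
Proof. exact: (sm_valP phi). Qed.

Definition linear_part (phi : aff_dual) : {linear V -> R^o} :=
  projT1 (cid (aff_dual_affine phi)).

Lemma linear_partE phi a v :
  \val phi (trans a v) = \val phi a + linear_part phi v.
Proof. by rewrite /linear_part; case: cid => /= l ->. Qed.

Lemma is_affine1 : is_affine (fun=> 1).
Proof. by exists \0 => a v /=; rewrite addr0. Qed.

Lemma aff_sumE (k : nat) (f : 'I_k -> R) (F : 'I_k -> aff_dual) a :
  \val (\sum_i f i *: F i) a = \sum_i f i * (\val (F i) a : R).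
Proof.
elim: k f F => [|k IHk] f F; first by rewrite !big_ord0.
by rewrite !big_ord_recl sm_valZD fctZD IHk.
Qed.

Definition aff_one : aff_dual := mk_sub (S := Submodule is_affine0 is_affineZD) is_affine1.

End AffineDual.

Section LinearDual.
Variable U : lmodType R.

Definition is_linear_form (f : U -> R^o) : Prop := linear f.

Lemma is_linear_form0 : is_linear_form 0.
Proof. by move=> a u v; rewrite scaler0 addr0. Qed.

Lemma is_linear_formZD c f g :
  is_linear_form f -> is_linear_form g -> is_linear_form (c *: f + g).
Proof.
move=> fl gl a u v; rewrite !fctZD fl gl.
have scE (x y : R) : x *: (y : R^o) = x * y by [].
by rewrite !scE !mulrDr !mulrA (mulrC c a) addrACA.
Qed.

Definition linear_dual : lmodType R :=
  sm_type (Submodule is_linear_form0 is_linear_formZD).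

Lemma linear_dualZD (z : linear_dual) a u v :
  \val z (a *: u + v) = a * (\val z u : R) + \val z v.
Proof. exact: (sm_valP z). Qed.

Lemma linear_dual_sumE (z : linear_dual) (k : nat) (f : 'I_k -> R) (F : 'I_k -> U) :
  \val z (\sum_i f i *: F i) = \sum_i f i * (\val z (F i) : R).
Proof.
elim: k f F => [|k IHk] f F.
  rewrite !big_ord0; have := linear_dualZD z 1 0 0.
  by rewrite scaler0 addr0 mul1r => /eqP; rewrite -subr_eq subrr => /eqP.
by rewrite !big_ord_recl linear_dualZD IHk.
Qed.

End LinearDual.

Section Bidual.
Variables (V : lmodType R) (E : affine_space V).

Definition bidual : lmodType R := linear_dual (aff_dual E).

Lemma canon_i_subproof (a : E) :
  is_linear_form (fun phi : aff_dual E => \val phi a : R^o).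
Proof. by move=> c f g; rewrite sm_valZD. Qed.

Definition canon_i (a : E) : bidual :=
  mk_sub (S := Submodule (@is_linear_form0 _) (@is_linear_formZD _))
         (canon_i_subproof a).

Lemma canon_bi_subproof (v : V) :
  is_linear_form (fun phi : aff_dual E => linear_part phi v : R^o).
Proof.
move=> c f g; case: (point_inhabited E) => a.
have valE x : \val (c *: f + g) x = c *: \val f x + \val g x.
  by rewrite sm_valZD.
apply: (addrI (\val (c *: f + g) a)); rewrite -linear_partE !valE.
by rewrite !linear_partE scalerDr addrACA.
Qed.

Definition canon_bi (v : V) : bidual :=
  mk_sub (S := Submodule (@is_linear_form0 _) (@is_linear_formZD _))
         (canon_bi_subproof v).

Lemma canon_bi_linear : linear canon_bi.
Proof.
move=> c u v; apply: val_inj; apply/funext => phi /=.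
by rewrite linearP.
Qed.

HB.instance Definition _ :=
  GRing.isLinear.Build R V bidual _ canon_bi canon_bi_linear.

Lemma canon_i_trans (a : E) (v : V) :
  canon_i (trans a v) = canon_i a + canon_bi v.
Proof. by apply: val_inj; apply/funext => phi; exact: linear_partE. Qed.

Definition canon_j (z : bidual) : R^o := \val z (aff_one E).

Lemma canon_j_linear : linear canon_j.
Proof. by move=> c u v; rewrite /canon_j sm_valZD. Qed.

HB.instance Definition _ :=
  GRing.isLinear.Build R bidual R^o _ canon_j canon_j_linear.

End Bidual.
End AffineSpaces.

Section AffineBundles.
Variables (R : realType) (n : nat) (M : manifold R n).

(* Local affine coordinates on the fibres, with their linear part. *)
Record affine_trivialization (V : M -> lmodType R)
    (E : forall p, affine_space (V p)) (k : nat) := AffTriv {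
  adom : set M;
  acoord : forall p, E p -> 'rV[R]_k;
  alin : forall p, {linear V p -> 'rV[R]_k};
  acoordD : forall p a v, acoord (trans a v) = acoord a + alin p v }.

Definition lin_triv (V : M -> lmodType R) (E : forall p, affine_space (V p))
    (k : nat) (e : affine_trivialization E k) : trivialization V k :=
  Triv (adom e) (alin e).

Record affine_bundle (k : nat) (V : vector_bundle M k) := AffineBundle {
  afib :> forall p, affine_space (V p);
  atrivs : set (affine_trivialization afib k);
  atriv_open : forall e, atrivs e -> open (adom e);
  atriv_cover : forall p, exists e, atrivs e /\ adom e p;
  atriv_bij : forall e, atrivs e -> forall p, adom e p -> bijective (alin e p);
  atriv_model : forall e t, atrivs e -> trivs V t ->
    smooth_matrix (fun p => idfun) t (lin_triv e);
  atriv_transition : forall e e', atrivs e -> atrivs e' ->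
    exists (g : M -> 'M[R]_k) (b : M -> 'rV[R]_k),
      [/\ smooth_mx (adom e `&` adom e') g, smooth_mx (adom e `&` adom e') b &
        forall p, adom e p -> adom e' p -> forall a : afib p,
          acoord e' a = acoord e a *m g p + b p] }.

Arguments atrivs {k V} a _.

Section BidualBundle.
Variables (k : nat) (V : vector_bundle M k) (E : affine_bundle V).
Implicit Types e : affine_trivialization E k.

Lemma acoord_affine e p j : is_affine (fun a : E p => acoord e a ord0 j : R^o).
Proof.
have lin : linear (fun v : V p => alin e p v ord0 j : R^o).
  by move=> c u v; rewrite linearP !mxE.
pose l : {linear V p -> R^o} := HB.pack_for {linear V p -> R^o}
  (fun v : V p => alin e p v ord0 j : R^o)
  (GRing.isLinear.Build R (V p) R^o _ _ lin).
by exists l => a v; rewrite acoordD mxE.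
Qed.

Definition acoord_fun e p j : aff_dual (E p) :=
  mk_sub (S := Submodule (@is_affine0 _ _ _) (@is_affineZD _ _ _))
         (@acoord_affine e p j).

(* The frame of the dual bundle E^dag given by the constant function 1 and the
   affine coordinates; bidual vectors are trivialized by their values on it. *)
Definition bidual_coord e p (z : bidual (E p)) : 'rV[R]_(1 + k) :=
  row_mx (canon_j z)%:M (\row_j \val z (acoord_fun e p j)).

Lemma bidual_coord_linear e p : linear (@bidual_coord e p).
Proof.
move=> c u v; rewrite /bidual_coord scale_row_mx add_row_mx scale_scalar_mx.
congr row_mx; first by rewrite -raddfD linearP.
by apply/rowP => j; rewrite !mxE sm_valZD.
Qed.

HB.instance Definition _ e p := GRing.isLinear.Build R (bidual (E p)) _ _
  (@bidual_coord e p) (@bidual_coord_linear e p).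

Definition bidual_triv e : trivialization (fun p => bidual (E p)) (1 + k) :=
  Triv (adom e) (fun p => @bidual_coord e p).

Definition bidual_prebundle : prebundle M (1 + k) :=
  Prebundle [set t | exists2 e, atrivs E e & t = bidual_triv e].

Lemma bidual_coord_bij e p : atrivs E e -> adom e p ->
  bijective (@bidual_coord e p).
Proof.
move=> Ee ep; have [h ah ha] := atriv_bij Ee ep.
have hlin : linear h by exact: can2_linear ah ha.
have [b] := point_inhabited (E p).
pose a0 := trans b (h (- acoord e b)).
have a00 : acoord e a0 = 0 by rewrite acoordD ha subrr.
have lin1 v : linear_part (aff_one (E p)) v = 0.
  have /= := linear_partE (aff_one (E p)) b v.
  by move/eqP; rewrite addrC -subr_eq subrr => /eqP.
have linc j v : linear_part (acoord_fun e p j) v = alin e p v ord0 j.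
  have /= := linear_partE (acoord_fun e p j) b v.
  by rewrite acoordD mxE => /addrI.
pose g (x : 'rV[R]_(1 + k)) : bidual (E p) :=
  lsubmx x ord0 ord0 *: canon_i a0 + canon_bi _ (h (rsubmx x)).
have gE x phi : \val (g x) phi = lsubmx x ord0 ord0 * (\val phi a0 : R)
                   + linear_part phi (h (rsubmx x)) by rewrite sm_valZD.
have gK : cancel g (@bidual_coord e p).
  move=> x; rewrite -[RHS]hsubmxK /bidual_coord; congr row_mx.
    rewrite [RHS]mx11_scalar /canon_j gE lin1 addr0; congr _%:M.
    exact: mulr1.
  apply/rowP => j; rewrite mxE gE linc ha /= a00 [X in _ * X]mxE mulr0 add0r.
  by congr (rsubmx x _ j); rewrite ord1.
have inj : injective (@bidual_coord e p).
  apply: raddf_inj => z z0; apply: val_inj; apply/funext => phi.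
  pose f (i : 'I_k) := linear_part phi (h (delta_mx 0 i)).
  have phiE : phi =
      \val phi a0 *: aff_one (E p) + \sum_i f i *: acoord_fun e p i.
    apply: val_inj; apply/funext => c; rewrite sm_valZD fctZD.
    have [v [cv _]] := trans_free_transitive a0 c.
    rewrite aff_sumE; have := linear_partE phi a0 v; rewrite cv => ->; rewrite -[v]ah.
    rewrite {1}(row_sum_delta (alin e p v)).
    pose hl : {linear 'rV[R]_k -> V p} := HB.pack_for {linear 'rV[R]_k -> V p} h
      (GRing.isLinear.Build R _ _ _ _ hlin).
    rewrite -[h]/(hl : _ -> _) !linear_sum mulr1; congr (_ + _).
    apply: eq_bigr => i _; rewrite !linearZ /= -cv acoordD a00 add0r.
    by rewrite (ord1 ord0); exact: mulrC.
  have z1 : \val z (aff_one (E p)) = 0.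
    have := congr1 (fun x => lsubmx x ord0 ord0) z0.
    by rewrite row_mxKl !mxE mulr1n.
  have zi i : \val z (acoord_fun e p i) = 0.
    by have := congr1 (fun x => rsubmx x ord0 i) z0; rewrite row_mxKr !mxE.
  rewrite phiE linear_dualZD linear_dual_sumE z1 mulr0 add0r.
  by rewrite big1 // => i _; rewrite zi mulr0.
exists g => //; exact: inj_can_sym gK inj.
Qed.

Lemma bidual_is_vector_bundle : is_vector_bundle bidual_prebundle.
Proof.
split=> /=.
- by move=> _ [e Ee ->]; exact: atriv_open Ee.
- by move=> _ [e Ee ->] p; exact: bidual_coord_bij.
- move=> p; have [e [Ee ep]] := atriv_cover E p.
  by exists (bidual_triv e); split=> //; exists e.
move=> _ _ [e Ee ->] [e' Ee' ->].
have [g [b [sg sb gb]]] := atriv_transition Ee Ee'.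
exists (fun p => block_mx 1%:M (b p) 0 (g p)); split=> /= [i j|p ep e'p z].
  case: (split_ordP i) => {}i ->; case: (split_ordP j) => {}j ->.
  - rewrite (_ : (fun p => _) = cst (1%:M i j)); last first.
      by apply/funext => p; rewrite block_mxEul.
    by move=> c _; exact: smooth_on_cst.
  - rewrite (_ : (fun p => _) = (fun p => b p i j)) //.
    by apply/funext => p; rewrite block_mxEur.
  - rewrite (_ : (fun p => _) = cst 0); last first.
      by apply/funext => p; rewrite block_mxEdl mxE.
    by move=> c _; exact: smooth_on_cst.
  - rewrite (_ : (fun p => _) = (fun p => g p i j)) //.
    by apply/funext => p; rewrite block_mxEdr.
rewrite /bidual_coord mul_row_block mulmx1 mulmx0 addr0 mul_scalar_mx; congr row_mx.
have -> : b p = \row_j b p ord0 j by apply/rowP => j; rewrite mxE.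
apply/rowP => j; rewrite !mxE.
have -> : acoord_fun e' p j =
    b p ord0 j *: aff_one (E p) + \sum_i g p i j *: acoord_fun e p i.
  apply: val_inj; apply/funext => a.
  rewrite sm_valZD fctZD aff_sumE [LHS]/= gb // !mxE addrC mulr1.
  by congr (_ + _); apply: eq_bigr => i _; rewrite mulrC.
rewrite linear_dualZD linear_dual_sumE mulrC; congr (_ + _).
by apply: eq_bigr => i _; rewrite !mxE mulrC.
Qed.

Definition bidual_bundle : vector_bundle M (1 + k) :=
  VectorBundle bidual_is_vector_bundle.

End BidualBundle.
End AffineBundles.

Section LieAlgebroids.
Variables (R : realType) (n : nat) (M : manifold R n).

(* The bracket is a total operation on set-theoretic sections; it is only
   constrained on smooth ones. *)
Record lie_algebroid (k : nat) (F : vector_bundle M k) := LieAlgebroid {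
  anchor : forall p, {linear F p -> tangent p};
  bracket : (forall p, F p) -> (forall p, F p) -> forall p, F p;
  anchor_smooth : smooth_hom (B := tangent_bundle M) anchor;
  bracket_smooth : forall s t, smooth_section s -> smooth_section t ->
    smooth_section (bracket s t);
  bracketZD : forall (a : R) s t u,
    smooth_section s -> smooth_section t -> smooth_section u -> forall p,
    bracket (fun q => a *: s q + t q) u p = a *: bracket s u p + bracket t u p;
  bracket_anti : forall s t, smooth_section s -> smooth_section t ->
    forall p, bracket s t p = - bracket t s p;
  bracket_jacobi : forall s t u,
    smooth_section s -> smooth_section t -> smooth_section u -> forall p,
    bracket s (bracket t u) p + bracket t (bracket u s) p
      + bracket u (bracket s t) p = 0;
  bracket_leibniz : forall s t (f : M -> R),
    smooth_section s -> smooth_section t -> smooth_fun setT f -> forall p,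
    bracket s (fun q => f q *: t q) p =
      f p *: bracket s t p + tangent_der (anchor p (s p)) f *: t p;
  anchor_bracket : forall s t (f : M -> R),
    smooth_section s -> smooth_section t -> smooth_fun setT f -> forall p,
    tangent_der (anchor p (bracket s t p)) f =
      tangent_der (anchor p (s p)) (fun q => tangent_der (anchor q (t q)) f)
      - tangent_der (anchor p (t p)) (fun q => tangent_der (anchor q (s q)) f) }.

(* A Lie algebroid structure on an affine bundle E is a Lie algebroid structure
   on its bidual for which brackets of sections of E are sections of V. *)
Record affine_lie_algebroid (k : nat) (V : vector_bundle M k)
    (E : affine_bundle V) := AffineLieAlgebroid {
  bidual_algebroid :> lie_algebroid (bidual_bundle E);
  bracket_affine : forall s t : (forall p, bidual_bundle E p),
    smooth_section s -> smooth_section t ->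
    (forall p, exists a : E p, s p = canon_i a) ->
    (forall p, exists a : E p, t p = canon_i a) ->
    forall p, exists v : V p, bracket bidual_algebroid s t p = canon_bi (E p) v }.

(* The anchor of the Lie algebroid induced on V. *)
Definition linear_anchor (k : nat) (V : vector_bundle M k) (E : affine_bundle V)
    (L : affine_lie_algebroid E) (p : M) : {linear V p -> tangent p} :=
  anchor L p \o canon_bi (E p).

End LieAlgebroids.

Section FibreBundles.
Variables (R : realType) (n : nat) (M : manifold R n).

Record fibre_bundle := FibreBundle {
  fb_dim : nat;
  fb_total :> manifold R fb_dim;
  fb_proj : fb_total -> M;
  fb_fdim : nat;
  fb_fibre : manifold R fb_fdim;
  fb_proj_smooth : smooth_map setT fb_proj;
  (* Local triviality: (fb_proj, psi) is a diffeomorphism from the part of the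
     bundle over U to U x fb_fibre, with inverse chi. *)
  fb_locally_trivial : forall m : M, exists (U : set M)
      (psi : fb_total -> fb_fibre) (chi : prod_manifold M fb_fibre -> fb_total),
    [/\ open U, U m, smooth_map (fb_proj @^-1` U) psi,
        @smooth_map R _ _ (prod_manifold M fb_fibre) fb_total (U `*` setT) chi &
        (forall q, U (fb_proj q) -> chi (fb_proj q, psi q) = q) /\
        (forall x y, U x -> fb_proj (chi (x, y)) = x /\ psi (chi (x, y)) = y)] }.

End FibreBundles.

Section Prolongation.
Variables (R : realType) (n : nat) (M : manifold R n) (k : nat).
Variables (F : vector_bundle M k) (rho : forall m, {linear F m -> tangent m}).
Variable P : fibre_bundle M.
Local Notation mu := (@fb_proj R n M P).

Definition in_prolongation (p : P) (zW : (F (mu p) * tangent p)%type) : Prop :=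
  rho (mu p) zW.1 = tangent_map mu p zW.2.

Lemma in_prolongation0 p : @in_prolongation p 0.
Proof. by rewrite /in_prolongation !raddf0. Qed.

Lemma in_prolongationZD p a u v : @in_prolongation p u ->
  @in_prolongation p v -> in_prolongation (a *: u + v).
Proof.
rewrite /in_prolongation => hu hv.
rewrite -[(_ + _).1]/(a *: u.1 + v.1) -[(_ + _).2]/(a *: u.2 + v.2).
by rewrite (linearP (rho _)) hu hv (linearP (tangent_map _ _)).
Qed.

(* The fibre at p of the prolongation L^F P. *)
Definition prolongation_fib (p : P) : lmodType R :=
  sm_type (Submodule (@in_prolongation0 p) (@in_prolongationZD p)).

Definition prolongation_fst (p : P) : {linear prolongation_fib p -> F (mu p)} :=
  fst \o \val.

Definition prolongation_snd (p : P) : {linear prolongation_fib p -> tangent p} :=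
  snd \o \val.

Definition pullback_triv (t : trivialization F k) :
    trivialization (fun p : P => F (mu p)) k :=
  @Triv _ _ P (fun p : P => F (mu p)) k (mu @^-1` tdom t)
        (fun p => tcoord t (mu p)).

(* L^F P has the smooth structure of a subbundle of mu^*F (+) TP: its
   trivializations are those in which the inclusion is smooth. *)
Definition prolongation_triv (t : trivialization prolongation_fib (k + fb_fdim P)) :
    Prop :=
  [/\ open (tdom t), forall p, tdom t p -> bijective (tcoord t p),
      forall s, trivs F s -> smooth_matrix prolongation_fst t (pullback_triv s) &
      forall s, trivs (tangent_bundle P) s -> smooth_matrix prolongation_snd t s].

Definition prolongation : prebundle P (k + fb_fdim P) :=
  Prebundle [set t | prolongation_triv t].

End Prolongation.

Section ProlongationMaps.
Variables (R : realType) (n : nat) (M : manifold R n) (k : nat).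
Variables (V : vector_bundle M k) (E : affine_bundle V).
Variables (L : affine_lie_algebroid E) (P : fibre_bundle M).

(* L^V P *)
Definition prolongation_V := prolongation (linear_anchor L) P.

(* L^{E~} P *)
Definition prolongation_bidual := prolongation (anchor L) P.

Lemma prolongation_I_subproof (p : P) (x : prolongation_V p) :
  in_prolongation (anchor L) (canon_bi (E (fb_proj p)) (\val x).1, (\val x).2).
Proof. exact: (sm_valP x). Qed.

(* (v, W) |-> (i v, W) *)
Definition prolongation_I_fun (p : P) (x : prolongation_V p) : prolongation_bidual p :=
  mk_sub (S := Submodule (@in_prolongation0 _ _ _ _ _ (anchor L) P p)
                         (@in_prolongationZD _ _ _ _ _ (anchor L) P p))
         (prolongation_I_subproof x).

Lemma prolongation_I_linear p : linear (@prolongation_I_fun p).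
Proof.
move=> a x y; apply: val_inj; apply: etrans (esym (sm_valZD _ _ _)).
rewrite -[LHS]/(canon_bi _ (\val (a *: x + y)).1, (\val (a *: x + y)).2).
rewrite (sm_valZD a x y) -[(_ + _).1]/(a *: (\val x).1 + (\val y).1).
by rewrite linearP.
Qed.

HB.instance Definition _ p := GRing.isLinear.Build R (prolongation_V p)
  (prolongation_bidual p) _ (@prolongation_I_fun p) (@prolongation_I_linear p).

Definition prolongation_I (p : P) :
    {linear prolongation_V p -> prolongation_bidual p} := @prolongation_I_fun p.

(* (z, W) |-> j z, in the fibre of P x R at p *)
Definition prolongation_J (p : P) :
    {linear prolongation_bidual p -> trivial_line_bundle P p} :=
  @canon_j R _ (E (fb_proj p)) \o prolongation_fst (anchor L) p.

End ProlongationMaps.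

(* Main.v *)
(* The fibre of L^F P at p sits inside F_(mu p) x T_p P.  In coordinates of P
   adapted to a local trivialization, T_p P splits into base and fibre
   directions, and the base component of W is dictated by rho z; so the
   coordinates of z together with the fibre component of W trivialize L^F P.
   A map into L^F P is smooth as soon as both its components are, because the
   matrix G of the inclusion into F x TP has independent rows and hence the
   smooth right inverse G^T (G G^T)^-1.  Exactness is fibrewise: j z = 0 holds
   precisely on the image of V, and J is onto because mu is a submersion. *)
Require Import Defs.
From HB Require Import structures.
From mathcomp Require Import all_boot all_order all_algebra.
From mathcomp Require Import all_classical all_reals all_analysis.
Set Implicit Arguments.
Unset Strict Implicit.
Unset Printing Implicit Defensive.
Import Order.TTheory GRing.Theory Num.Theory numFieldNormedType.Exports.
Local Open Scope classical_set_scope.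
Local Open Scope ring_scope.

(** * Calculus in coordinates *)

(** Tangent vectors at [p] are stored as components in [chart_at p], a chart chosen for each [p]
    separately with no continuity in [p]. Smoothness cannot be read off these components, so every
    computation is moved to [tangent_triv c] for a chart [c] fixed near the point.

    The trivializations of the prolongation are not listed but characterized: all those in which the
    inclusion is smooth. Two facts therefore need proof: that smoothness after the inclusion implies
    smoothness before it, and that such trivializations exist near every point.

    The dimensions [fb_dim P] and [n + fb_fdim P] are not assumed equal, so adapted coordinates are
    handled by a formally rectangular matrix with a two-sided inverse.

    Smoothness is treated as a property at a point; charts, trivializations and matrices can then be
    chosen anew at each point, and the matrices are glued at the end by uniqueness. *)

Lemma near_forall (T : topologicalType) (I : finType) (P : I -> T -> Prop) (x : T) :
  (forall i, \forall y \near x, P i y) -> \forall y \near x, forall i, P i y.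
Proof. by move=> nP; apply: filter_forall. Qed.

Section Differentiability.
Variable R : realType.

(** The difference [g - f] vanishes near [x], so its differential there is [0]; adding it to [f]
    keeps differentiability. *)
Lemma near_eq_differentiable (V W : normedModType R) (f g : V -> W) (x : V) :
  {near x, f =1 g} -> differentiable f x -> differentiable g x.
Proof.
move=> fg df; have -> : g = f + (g \- f).
  by apply/funext => y /=; rewrite !fctE addrC subrK.
apply: differentiableD => //.
have h0 : \forall h \near 0, ((g \- f) \o shift x) h = 0.
  have : \forall y \near x, (g \- f) y = 0.
    by near=> y; rewrite /= (near fg y) ?subrr.
  rewrite (near_shift 0) subr0 => ?; near=> h => /=.
  by near: h; under eq_near do rewrite /=.
have e0 : (g \- f) \o shift x = cst ((g \- f) x) + (\0 : V -> W) +o_ 0 id.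
  apply/eqaddoP => _/posnumP[e]; near=> h.
  rewrite /= !fctE (nbhs_singleton fg) subrr /= !(add0r,addr0,subr0,oppr0).
  have /= -> := near h0 h; last by [].
  by rewrite normr0 mulr_ge0.
have d0 : 'd (g \- f) x = \0 :> (V -> W).
  by apply: diff_unique e0 => y; exact: cst_continuous.
by apply/diff_locallyP; rewrite d0; split=> // y; exact: cst_continuous.
Unshelve. all: by end_near. Qed.

Lemma differentiable_rowP (V : normedModType R) (n : nat) (f : V -> 'rV[R]_n) x :
  (forall j, differentiable (fun y => f y ord0 j) x) -> differentiable f x.
Proof.
move=> df.
have -> : f = \sum_(j < n) (fun y => f y ord0 j *: delta_mx 0 j).
  apply/funext => y; by rewrite fct_sumE [LHS]row_sum_delta.
apply: differentiable_sum => j; exact: differentiableZl.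
Qed.

Lemma jacobianE (n m : nat) (f : 'rV[R]_n -> 'rV[R]_m) x i j :
  differentiable f x ->
  'J f x i j = 'D_(delta_mx 0 i) (fun y => f y ord0 j) x.
Proof.
move=> df; have := deriveEjacobian (delta_mx 0 i) df; rewrite -rowE => /rowP/(_ j).
rewrite derive_mx; last exact: diff_derivable.
by rewrite !mxE => ->.
Qed.

Lemma near_eq_jacobian (n m : nat) (f g : 'rV[R]_n -> 'rV[R]_m) x :
  {near x, f =1 g} -> differentiable f x -> 'J f x = 'J g x.
Proof.
move=> fg df; have dg := near_eq_differentiable fg df.
apply/matrixP => i j.
transitivity ('D_(delta_mx 0 i) (fun y => f y ord0 j) x : R); first exact: jacobianE.
transitivity ('D_(delta_mx 0 i) (fun y => g y ord0 j) x : R); last exact/esym/jacobianE.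
apply: near_eq_derive.
by near=> y; rewrite (near fg y).
Unshelve. all: by end_near. Qed.

Lemma mulmx_jacobian (n m : nat) (f : 'rV[R]_n -> 'rV[R]_m) x v :
  v *m 'J f x = 'd f x v.
Proof. exact: mul_rV_lin1. Qed.

(** Jacobians act on row vectors from the right, hence the order of the factors. *)
Lemma jacobian_comp (n m l : nat) (f : 'rV[R]_n -> 'rV[R]_m)
    (g : 'rV[R]_m -> 'rV[R]_l) x :
  differentiable f x -> differentiable g (f x) ->
  'J (g \o f) x = 'J f x *m 'J g (f x).
Proof.
move=> df dg; apply/row_matrixP => i; rewrite !rowE mulmxA.
transitivity ('d (g \o f) x (delta_mx 0 i)); first exact: mulmx_jacobian.
transitivity ('d g (f x) ('d f x (delta_mx 0 i))).
  by have := diff_comp df dg; move/(congr1 (fun h => h (delta_mx 0 i))).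
by apply/esym; transitivity ('d f x (delta_mx 0 i) *m 'J g (f x));
  [congr mulmx|]; exact: mulmx_jacobian.
Qed.

Lemma jacobian_id (n : nat) (x : 'rV[R]_n) : 'J id x = 1%:M.
Proof.
apply/row_matrixP => i; rewrite !rowE mulmx1.
transitivity ('d id x (delta_mx 0 i)); first exact: mulmx_jacobian.
have := @diff_val _ _ _ _ _ _ _ (is_diff_id x).
by move/(congr1 (fun h => h (delta_mx 0 i))).
Qed.

End Differentiability.

(** * Closure properties of functions of class C^k and of smooth germs *)

Section SmoothCalculus.
Variable R : realType.
Implicit Types (k n m : nat).

Lemma Ck_sub k n (A B : set 'rV[R]_n) f : B `<=` A -> Ck k A f -> Ck k B f.
Proof.
move=> BA; elim: k f => [|k IHk] f /= => [cf x /BA|[df cf]]; first exact: cf.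
by split=> [x /BA|v]; [exact: df|exact/IHk/cf].
Qed.

(** Openness turns equality on [A] into equality near each of its points, so the derivatives agree
    on [A] as well and the induction continues. *)
Lemma Ck_eq k n (A : set 'rV[R]_n) f g : open A -> {in A, f =1 g} ->
  Ck k A f -> Ck k A g.
Proof.
move=> oA; elim: k f g => [|k IHk] f g fg /=.
  move=> cf x Ax; have fgx : {near x, f =1 g}.
    by apply: filterS (open_nbhs_nbhs (conj oA Ax)) => y Ay; exact/fg/mem_set.
  rewrite /prop_for /continuous_at -(nbhs_singleton fgx).
  by apply: cvg_trans (cf x Ax); exact: near_eq_cvg fgx.
have nfg x : A x -> {near x, f =1 g}.
  by move=> Ax; apply: filterS (open_nbhs_nbhs (conj oA Ax)) => y Ay; exact/fg/mem_set.
case=> df cf; split=> [x Ax|v]; first exact: near_eq_differentiable (nfg _ Ax) (df _ Ax).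
apply: IHk (cf v) => x /set_mem Ax; apply: near_eq_derive.
by near=> y; rewrite (near (nfg x Ax) y).
Unshelve. all: by end_near. Qed.

Lemma Ck_continuous k n (A : set 'rV[R]_n) f x : Ck k A f -> A x -> {for x, continuous f}.
Proof.
case: k => [|k] /= => [cf Ax|[df _] Ax]; first exact: cf.
exact/differentiable_continuous/df.
Qed.

Lemma CkW k n (A : set 'rV[R]_n) f : Ck k.+1 A f -> Ck k A f.
Proof.
elim: k f => [|k IHk] f; first by move=> cf x; exact: Ck_continuous cf.
by case=> df cf; split=> // v; exact/IHk/cf.
Qed.

Lemma CkD k n (A : set 'rV[R]_n) f g : open A ->
  Ck k A f -> Ck k A g -> Ck k A (fun x => f x + g x).
Proof.
move=> oA; elim: k f g => [|k IHk] f g.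
  by move=> cf cg x Ax; apply: continuousD; [exact: cf|exact: cg].
case=> df cf [dg cg]; split=> [x Ax|v].
  by apply: differentiableD; [exact: df|exact: dg].
apply: Ck_eq (IHk _ _ (cf v) (cg v)) => // x /set_mem Ax.
by rewrite deriveD //; apply: diff_derivable; [exact: df|exact: dg].
Qed.

Lemma CkM k n (A : set 'rV[R]_n) f g : open A ->
  Ck k A f -> Ck k A g -> Ck k A (fun x => f x * g x).
Proof.
move=> oA; elim: k f g => [|k IHk] f g.
  by move=> cf cg x Ax; apply: continuousM; [exact: cf|exact: cg].
move=> cf' cg'; have [df cf] := cf'; have [dg cg] := cg'; split=> [x Ax|v].
  by apply: differentiableM; [exact: df|exact: dg].
(* Product rule; the undifferentiated factors are only needed at one order less, whence [CkW]. *)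
have := CkD oA (IHk _ _ (CkW cf') (cg v)) (IHk _ _ (CkW cg') (cf v)).
apply: Ck_eq => // x /set_mem Ax.
by rewrite [RHS]deriveM //; apply: diff_derivable; [exact: df|exact: dg].
Qed.

Lemma Ck_cst k n (A : set 'rV[R]_n) c : Ck k A (fun=> c).
Proof. exact: smooth_on_cst. Qed.

Lemma Ck_sum k n (A : set 'rV[R]_n) m (F : 'I_m -> 'rV[R]_n -> R) : open A ->
  (forall i, Ck k A (F i)) -> Ck k A (fun x => \sum_i F i x).
Proof.
move=> oA cF; elim: m F cF => [|m IHm] F cF.
  under eq_fun do rewrite big_ord0; exact: Ck_cst.
by under eq_fun do rewrite big_ord_recl; apply: CkD => //; exact: IHm.
Qed.

Lemma CkV k n (A : set 'rV[R]_n) f : open A -> (forall x, A x -> f x != 0) ->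
  Ck k A f -> Ck k A (fun x => (f x)^-1).
Proof.
move=> oA f0; elim: k => [|k IHk].
  by move=> cf x Ax; apply: continuousV; [exact: f0|exact: cf].
move=> cf'; have [df cf] := cf'; split=> [x Ax|v].
  by apply: differentiableV; [exact: df|exact: f0].
have cV := IHk (CkW cf').
(* The derivative of [1/f] is [-(1/f)^2 D_v f], to which the induction hypothesis applies. *)
have := CkM oA (Ck_cst k A (-1)) (CkM oA (CkM oA cV cV) (cf v)).
apply: Ck_eq => // x /set_mem Ax; rewrite deriveV ?f0 //; last exact/diff_derivable/df.
by rewrite mulN1r scaleNr expr2 invfM.
Qed.

(** Induction on [k] with [g] general: by the chain rule [D_v (g o f)] is the sum over [j] of
    [(D_j g o f) * D_v f_j], and [D_j g] has one order less than [g]. *)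
Lemma Ck_comp k n m (A : set 'rV[R]_n) (B : set 'rV[R]_m)
    (f : 'rV[R]_n -> 'rV[R]_m) g : open A -> (forall x, A x -> B (f x)) ->
  (forall x, A x -> differentiable f x) ->
  (forall j, Ck k A (fun x => f x ord0 j)) -> Ck k B g -> Ck k A (g \o f).
Proof.
move=> oA AB df; elim: k g => [|k IHk] g cf cg.
  move=> x Ax; apply: continuous_comp; first exact/differentiable_continuous/df.
  by apply: cg; exact: AB.
have [dg cDg] := cg; split=> [x Ax|v].
  by apply: differentiable_comp; [exact: df|apply: dg; exact: AB].
have := @Ck_sum k n A m (fun j x =>
    ('D_(delta_mx 0 j) g \o f) x * 'D_v (fun y => f y ord0 j) x) oA.
have cD j : Ck k A (fun x => ('D_(delta_mx 0 j) g \o f) x * 'D_v (fun y => f y ord0 j) x).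
  apply: CkM => //; first by apply: IHk => [i|]; [exact/CkW/cf|exact: cDg].
  by have [_] := cf j; exact.
move=> /(_ cD); apply: Ck_eq => // x /set_mem Ax.
have dgx : differentiable g (f x) by apply: dg; exact: AB.
have dfx := df x Ax.
rewrite deriveE; last exact: differentiable_comp.
rewrite diff_comp //= -[X in 'd g (f x) X]deriveE // derive_mx; last exact: diff_derivable.
rewrite [X in 'd g (f x) X]row_sum_delta linear_sum; apply: eq_bigr => j _.
by rewrite linearZ -deriveE // !mxE mulrC.
Qed.

(** Smoothness of a germ: the domain may shrink freely under sums, inverses and compositions. *)
Definition smooth_at n (f : 'rV[R]_n -> R) (x : 'rV[R]_n) : Prop :=
  exists A : set 'rV[R]_n, [/\ open A, A x & smooth_on A f].

(** Each clause of [Ck] constrains one point at a time, and [D_v f] is smooth at every point where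
    [f] is, so induction on [k] applies. *)
Lemma smooth_onP n (A : set 'rV[R]_n) f : open A ->
  smooth_on A f <-> forall x, A x -> smooth_at f x.
Proof.
move=> oA; split=> [sf x Ax|sf k]; first by exists A.
elim: k f sf => [|k IHk] f sf; first by move=> x /sf[B [oB Bx /(_ 0)]]; exact.
split=> [x /sf[B [oB Bx /(_ 1)[+ _]]]|v]; first exact.
apply: IHk => x /sf[B [oB Bx sfB]]; exists B; split=> // l.
by have [_] := sfB l.+1; exact.
Qed.

Lemma near_smooth_at n (f : 'rV[R]_n -> R) x :
  smooth_at f x -> \forall y \near x, smooth_at f y.
Proof.
case=> A [oA Ax sf]; apply: filterS (open_nbhs_nbhs (conj oA Ax)) => y Ay.
by exists A.
Qed.

Lemma smooth_at_eq n (f g : 'rV[R]_n -> R) x :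
  {near x, f =1 g} -> smooth_at f x -> smooth_at g x.
Proof.
rewrite {1}/prop_near1 nbhsE => -[B [oB Bx] fg] [A [oA Ax sf]].
exists (A `&` B); split=> [||k]; [exact: openI|by []|].
have : Ck k (A `&` B) f by apply: Ck_sub (sf k) => y [].
by apply: Ck_eq => [|y /set_mem[_ By]]; [exact: openI|exact: fg].
Qed.

Lemma smooth_at_differentiable n (f : 'rV[R]_n -> R) x :
  smooth_at f x -> differentiable f x.
Proof. by case=> A [_ Ax /(_ 1)[+ _]]; exact. Qed.

Lemma smooth_at_derive n (f : 'rV[R]_n -> R) v x :
  smooth_at f x -> smooth_at ('D_v f) x.
Proof. by case=> A [oA Ax sf]; exists A; split=> // k; have [_] := sf k.+1; exact. Qed.

Lemma smooth_at_cst n c (x : 'rV[R]_n) : smooth_at (fun=> c) x.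
Proof. by exists setT; split=> //; [exact: openT|exact: smooth_on_cst]. Qed.

Lemma smooth_atD n (f g : 'rV[R]_n -> R) x :
  smooth_at f x -> smooth_at g x -> smooth_at (fun y => f y + g y) x.
Proof.
move=> [A [oA Ax sf]] [B [oB Bx sg]]; have oAB := openI oA oB.
by exists (A `&` B); split=> // k; apply: CkD => //;
  [apply: Ck_sub (sf k) => y []|apply: Ck_sub (sg k) => y []].
Qed.

Lemma smooth_atM n (f g : 'rV[R]_n -> R) x :
  smooth_at f x -> smooth_at g x -> smooth_at (fun y => f y * g y) x.
Proof.
move=> [A [oA Ax sf]] [B [oB Bx sg]]; have oAB := openI oA oB.
by exists (A `&` B); split=> // k; apply: CkM => //;
  [apply: Ck_sub (sf k) => y []|apply: Ck_sub (sg k) => y []].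
Qed.

Lemma smooth_atV n (f : 'rV[R]_n -> R) x :
  f x != 0 -> smooth_at f x -> smooth_at (fun y => (f y)^-1) x.
Proof.
move=> fx0 sfx; have [A [oA Ax sf]] := sfx.
have : \forall y \near x, f y != 0.
  have /differentiable_continuous cfx := smooth_at_differentiable sfx.
  apply: (cfx [set y | y != 0]); apply: open_nbhs_nbhs; split=> //.
rewrite {1}/prop_near1 nbhsE => -[B [oB Bx] f0]; have oAB := openI oA oB.
exists (A `&` B); split=> // k; apply: CkV => // [y [_ /f0]//|].
by apply: Ck_sub (sf k) => y [].
Qed.

Lemma smooth_at_comp n m (f : 'rV[R]_n -> 'rV[R]_m) g x :
  (forall j, smooth_at (fun y => f y ord0 j) x) -> smooth_at g (f x) ->
  smooth_at (g \o f) x.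
Proof.
move=> sf [B [oB Bfx sg]].
have nsf : \forall y \near x, forall j, smooth_at (fun y => f y ord0 j) y.
  by apply: near_forall => j; exact: near_smooth_at.
have dfx : differentiable f x.
  by apply: differentiable_rowP => j; exact: smooth_at_differentiable.
have nB : \forall y \near x, B (f y).
  by apply: (differentiable_continuous dfx); exact: open_nbhs_nbhs.
have : \forall y \near x, (forall j, smooth_at (fun y => f y ord0 j) y) /\ B (f y).
  by near=> y; split; [exact: (near nsf y)|exact: (near nB y)].
(* [A] is an open set on which all coordinates of [f] are smooth and which [f] sends into [B], as
   [Ck_comp] requires. *)
rewrite {1}/prop_near1 nbhsE => -[A [oA Ax] AB].
exists A; split=> // k; apply: Ck_comp (sg k) => // [y /AB[]//|y /AB[sfy _]|j].
  by apply: differentiable_rowP => j; exact: smooth_at_differentiable.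
by have /(_ k) := (smooth_onP (fun y => f y ord0 j) oA).2 (fun y Ay => (AB y Ay).1 j).
Unshelve. all: by end_near. Qed.

End SmoothCalculus.

(** * Smooth functions and maps on manifolds *)

Section ChartExpressions.
Variable R : realType.

(** The coordinate representative of [f]; for [f = id] it is a transition map. The Jacobians in
    [tangent_map] and [tangent_triv] are convertible to Jacobians of it. *)
Definition chart_expr (T T' : Type) (n n' : nat) (c : chart R T n)
    (d : chart R T' n') (f : T -> T') (x : 'rV[R]_n) : 'rV[R]_n' :=
  d (f (cinv c x)).

(** As [cinv c] is continuous on the open image of [c], points near [c p] come from points of
    [U]. *)
Lemma chart_image_open (T : topologicalType) (n : nat) (c : chart R T n)
    (U : set T) : is_chart c -> open U -> open (c @` (cdom c `&` U)).
Proof.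
move=> [oc oi cK cc ci] oU.
rewrite openE => _ [p [cp Up] <-]; rewrite /interior.
have nU : \forall x \near c p, U (cinv c x).
  apply: (ci (c p)); first by exists p.
  by rewrite cK //; apply: open_nbhs_nbhs.
have ni : \forall x \near c p, (c @` cdom c) x.
  by apply: open_nbhs_nbhs; split=> //; exists p.
near=> x; have [q cq qx] : (c @` cdom c) x by near: x.
exists q => //; split=> //; rewrite -(cK _ cq) qx; near: x; exact: nU.
Unshelve. all: by end_near. Qed.

Lemma near_cinv (T : topologicalType) (n : nat) (c : chart R T n) (p : T)
    (Q : T -> Prop) : is_chart c -> cdom c p ->
  (\forall q \near p, Q q) -> \forall x \near c p, Q (cinv c x).
Proof.
move=> [oc oi cK cc ci] cp nQ; apply: (ci (c p)); first by exists p.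
by rewrite cK.
Qed.

Lemma near_cdom (T : topologicalType) (n : nat) (c : chart R T n) (p : T) :
  is_chart c -> cdom c p -> \forall q \near p, cdom c q.
Proof. by move=> [oc _ _ _ _] cp; apply: open_nbhs_nbhs. Qed.

Lemma near_cmap (T : topologicalType) (n : nat) (c : chart R T n) (p : T)
    (Q : 'rV[R]_n -> Prop) : is_chart c -> cdom c p ->
  (\forall x \near c p, Q x) -> \forall q \near p, Q (c q).
Proof. by move=> [oc oi cK cc ci] cp nQ; apply: (cc p cp). Qed.

Lemma near_cinvK (T : topologicalType) (n : nat) (c : chart R T n) (p : T) :
  is_chart c -> cdom c p -> \forall x \near c p, c (cinv c x) = x.
Proof.
move=> [oc oi cK cc ci] cp.
have : \forall x \near c p, (c @` cdom c) x.
  by apply: open_nbhs_nbhs; split=> //; exists p.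
by apply: filterS => _ [q cq <-]; rewrite cK.
Qed.

(** By continuity of [f], points near [p] are sent into the domain of [d]; there [cinv d] undoes [d]
    in the middle, and the ordinary chain rule applies. *)
Lemma jacobian_chart_comp (T T' : topologicalType) (T'' : Type) (n n' n'' : nat)
    (c : chart R T n) (d : chart R T' n') (e : chart R T'' n'')
    (f : T -> T') (g : T' -> T'') (p : T) :
  is_chart c -> is_chart d -> cdom c p -> cdom d (f p) ->
  {for p, continuous f} ->
  differentiable (chart_expr c d f) (c p) ->
  differentiable (chart_expr d e g) (d (f p)) ->
  'J (chart_expr c e (g \o f)) (c p) =
    'J (chart_expr c d f) (c p) *m 'J (chart_expr d e g) (d (f p)).
Proof.
move=> hc hd cp dfp cf dif dig.
have [_ _ cK _ _] := hc; have [_ _ dK _ _] := hd.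
have fp : chart_expr c d f (c p) = d (f p) by rewrite /chart_expr cK.
have dig' : differentiable (chart_expr d e g) (chart_expr c d f (c p)) by rewrite fp.
rewrite -fp; transitivity ('J (chart_expr d e g \o chart_expr c d f) (c p));
  last exact: jacobian_comp.
apply/esym/near_eq_jacobian; last exact: differentiable_comp.
apply: (near_cinv (Q := fun q => e (g (cinv d (d (f q)))) = e (g (f q)))) => //.
have : \forall q \near p, cdom d (f q) by apply: cf; exact: near_cdom.
by apply: filterS => q dq; rewrite dK.
Qed.

Lemma jacobian_chart_id (T : topologicalType) (n : nat) (c : chart R T n)
    (f : T -> T) (p : T) :
  is_chart c -> cdom c p -> (\forall q \near p, f q = q) ->
  'J (chart_expr c c f) (c p) = 1%:M.
Proof.
move=> hc cp nf; rewrite -(jacobian_id (c p)).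
apply/esym/near_eq_jacobian; last exact: (@ex_diff _ _ _ _ _ _ _ (is_diff_id _)).
have := near_cinv hc cp nf; have := near_cinvK hc cp.
by apply: filterS2 => x; rewrite /chart_expr => xK ->; rewrite xK.
Qed.

End ChartExpressions.

Section SmoothFunctions.
Variable R : realType.

Definition smooth_fun_at (n : nat) (M : premanifold R n) (f : M -> R) (p : M) : Prop :=
  exists c, [/\ atlas M c, cdom c p & smooth_at (f \o cinv c) (c p)].

Definition smooth_map_at (n n' : nat) (M : premanifold R n) (N : premanifold R n')
    (f : M -> N) (p : M) : Prop :=
  {for p, continuous f} /\
  forall d, atlas N d -> cdom d (f p) ->
    forall j, smooth_fun_at (fun q => d (f q) ord0 j) p.

Lemma atlas_is_chart (n : nat) (M : manifold R n) c : atlas M c -> is_chart c.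
Proof. by have [_ + _ _] := manifoldP M; exact. Qed.

Section Charts.
Variables (n : nat) (M : manifold R n).
Implicit Types (p : M) (f g : M -> R).

Lemma smooth_at_transition c d p : atlas M c -> atlas M d -> cdom c p -> cdom d p ->
  forall j, smooth_at (fun x => chart_expr c d id x ord0 j) (c p).
Proof.
move=> Mc Md cp dp j; have [_ _ _ /(_ c d Mc Md j)] := manifoldP M.
rewrite smooth_onP; last first.
  apply: chart_image_open; first exact: (atlas_is_chart Mc).
  by have [] := atlas_is_chart Md.
by apply; exists p.
Qed.

(** Near [c p], [f o cinv c] is [f o cinv d] after a smooth transition map. The chart in
    [smooth_fun_at] may thus be replaced by any other around [p]. *)
Lemma smooth_fun_at_chart f c p : atlas M c -> cdom c p -> smooth_fun_at f p ->
  smooth_at (f \o cinv c) (c p).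
Proof.
move=> Mc cp [d [Md dp sf]].
have [hc hd] := (atlas_is_chart Mc, atlas_is_chart Md).
have [_ _ cK _ _] := hc; have [_ _ dK _ _] := hd.
have e : chart_expr c d id (c p) = d p by rewrite /chart_expr cK.
have : smooth_at ((f \o cinv d) \o chart_expr c d id) (c p).
  by apply: smooth_at_comp; [exact: smooth_at_transition|rewrite e].
apply: smooth_at_eq.
apply: (near_cinv (Q := fun q => f (cinv d (d q)) = f q)) => //.
by apply: filterS (near_cdom hd dp) => q dq; rewrite dK.
Qed.

Lemma near_smooth_fun_at f p :
  smooth_fun_at f p -> \forall q \near p, smooth_fun_at f q.
Proof.
move=> [c [Mc cp sf]]; have hc := atlas_is_chart Mc.
have := near_cmap hc cp (near_smooth_at sf); have := near_cdom hc cp.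
by apply: filterS2 => q cq sq; exists c.
Qed.

Lemma smooth_fun_at_eq f g p : {near p, f =1 g} -> smooth_fun_at f p -> smooth_fun_at g p.
Proof.
move=> fg [c [Mc cp sf]]; exists c; split=> //.
by apply: smooth_at_eq sf; exact: (near_cinv (atlas_is_chart Mc) cp fg).
Qed.

Lemma smooth_fun_at_coord c h p : atlas M c -> cdom c p -> smooth_at h (c p) ->
  smooth_fun_at (h \o c) p.
Proof.
move=> Mc cp sh; exists c; split=> //; apply: smooth_at_eq sh.
by apply: filterS (near_cinvK (atlas_is_chart Mc) cp) => x /= ->.
Qed.

Lemma smooth_funP (U : set M) f : open U ->
  smooth_fun U f <-> forall p, U p -> smooth_fun_at f p.
Proof.
move=> oU; split=> sf.
  move=> p Up; have [c [Mc cp]] := chart_exists p.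
  exists c; split=> //; have := sf c Mc; rewrite smooth_onP.
    by apply; exists p.
  exact/chart_image_open/oU/atlas_is_chart.
move=> c Mc; rewrite smooth_onP; last exact/chart_image_open/oU/atlas_is_chart.
move=> _ [p [cp Up] <-]; exact/smooth_fun_at_chart/sf.
Qed.

Lemma smooth_fun_at_cst a p : smooth_fun_at (fun=> a) p.
Proof.
by have [c [Mc cp]] := chart_exists p; exists c; split=> //; exact: smooth_at_cst.
Qed.

Lemma smooth_fun_atD f g p : smooth_fun_at f p -> smooth_fun_at g p ->
  smooth_fun_at (fun q => f q + g q) p.
Proof.
move=> [c [Mc cp sf]] sg; exists c; split=> //.
by apply: smooth_atD => //; exact: (smooth_fun_at_chart Mc cp sg).
Qed.

Lemma smooth_fun_atM f g p : smooth_fun_at f p -> smooth_fun_at g p ->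
  smooth_fun_at (fun q => f q * g q) p.
Proof.
move=> [c [Mc cp sf]] sg; exists c; split=> //.
by apply: smooth_atM => //; exact: (smooth_fun_at_chart Mc cp sg).
Qed.

Lemma smooth_fun_atV f p : f p != 0 -> smooth_fun_at f p ->
  smooth_fun_at (fun q => (f q)^-1) p.
Proof.
move=> fp [c [Mc cp sf]]; exists c; split=> //; apply: smooth_atV => //=.
by have [_ _ -> //] := atlas_is_chart Mc.
Qed.

Lemma smooth_fun_at_sum (I : Type) (r : seq I) (F : I -> M -> R) p :
  (forall i, smooth_fun_at (F i) p) -> smooth_fun_at (fun q => \sum_(i <- r) F i q) p.
Proof.
move=> sF; elim: r => [|i r IHr].
  by under eq_fun do rewrite big_nil; exact: smooth_fun_at_cst.
by under eq_fun do rewrite big_cons; exact: smooth_fun_atD.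
Qed.

Lemma smooth_fun_at_prod (I : Type) (r : seq I) (F : I -> M -> R) p :
  (forall i, smooth_fun_at (F i) p) -> smooth_fun_at (fun q => \prod_(i <- r) F i q) p.
Proof.
move=> sF; elim: r => [|i r IHr].
  by under eq_fun do rewrite big_nil; exact: smooth_fun_at_cst.
by under eq_fun do rewrite big_cons; exact: smooth_fun_atM.
Qed.

Lemma smooth_map_at_id p : smooth_map_at id p.
Proof.
split=> [|d Md dp j]; first by move=> A.
exists d; split=> //; apply: (smooth_at_transition Md Md) => //.
Qed.

End Charts.

Section Maps.
Variables (n n' : nat) (M : manifold R n).

Lemma smooth_map_atP (N : premanifold R n') (U : set M) (f : M -> N) p :
  (forall d, atlas N d -> open (cdom d)) ->
  open U -> smooth_map U f -> U p -> smooth_map_at f p.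
Proof.
move=> oN oU [cf sf] Up; split=> [|d Nd dfp j]; first exact: cf.
have [c [Mc cp]] := chart_exists p; exists c; split=> //.
have := sf c d Mc Nd j.
have oW : open (U `&` f @^-1` cdom d).
  rewrite openE => q [Uq dq]; apply: filterI; first exact: open_nbhs_nbhs.
  by apply: (cf q Uq); apply: open_nbhs_nbhs; split=> //; exact: oN.
rewrite smooth_onP; first by apply; exists p => //; split.
rewrite -setIA; exact/chart_image_open/oW/atlas_is_chart.
Qed.

Variable N : manifold R n'.

Lemma smooth_fun_at_comp (f : M -> N) (g : N -> R) p :
  smooth_map_at f p -> smooth_fun_at g (f p) -> smooth_fun_at (g \o f) p.
Proof.
move=> [cf sf] [d [Nd dfp sg]].
have [c [Mc cp]] := chart_exists p; exists c; split=> //.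
have [hc hd] := (atlas_is_chart Mc, atlas_is_chart Nd).
have [_ _ cK _ _] := hc; have [_ _ dK _ _] := hd.
have : smooth_at ((g \o cinv d) \o chart_expr c d f) (c p).
  apply: smooth_at_comp => [j|]; last by rewrite /chart_expr cK.
  exact: (smooth_fun_at_chart Mc cp (sf d Nd dfp j)).
apply: smooth_at_eq.
apply: (near_cinv (Q := fun q => g (cinv d (d (f q))) = g (f q))) => //.
have : \forall q \near p, cdom d (f q) by apply: cf; exact: near_cdom.
by apply: filterS => q dq; rewrite dK.
Qed.

Lemma smooth_at_chart_expr (f : M -> N) c d p : atlas M c -> atlas N d ->
  cdom c p -> cdom d (f p) -> smooth_map_at f p ->
  forall j, smooth_at (fun x => chart_expr c d f x ord0 j) (c p).
Proof.
by move=> Mc Nd cp dfp [_ sf] j; exact: (smooth_fun_at_chart Mc cp (sf d Nd dfp j)).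
Qed.

Lemma differentiable_chart_expr (f : M -> N) c d p : atlas M c -> atlas N d ->
  cdom c p -> cdom d (f p) -> smooth_map_at f p ->
  differentiable (chart_expr c d f) (c p).
Proof.
move=> Mc Nd cp dfp sf; apply: differentiable_rowP => j.
exact/smooth_at_differentiable/smooth_at_chart_expr.
Qed.

End Maps.

Lemma smooth_jacobian_at (n m : nat) (M : manifold R n) (F : 'rV[R]_n -> 'rV[R]_m) c p :
  atlas M c -> cdom c p -> (forall j, smooth_at (fun x => F x ord0 j) (c p)) ->
  forall i j, smooth_fun_at (fun q => 'J F (c q) i j) p.
Proof.
move=> Mc cp sF i j.
have := smooth_fun_at_coord Mc cp (smooth_at_derive (delta_mx 0 i) (sF j)).
apply: smooth_fun_at_eq.
(* Jacobian entries are identified with partial derivatives only where [F] is known to be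
   differentiable, that is near [c p]. *)
apply: (near_cmap (Q := fun x =>
  'D_(delta_mx 0 i) (fun y => F y ord0 j) x = 'J F x i j)) => //.
  exact: atlas_is_chart.
have nF : \forall x \near c p, forall j, smooth_at (fun y => F y ord0 j) x.
  by apply: near_forall => k; exact: near_smooth_at.
apply: filterS nF => x sFx; apply/esym/jacobianE.
by apply: differentiable_rowP => k; exact: smooth_at_differentiable.
Qed.

End SmoothFunctions.

(** * Smooth matrices and bundle maps *)

Section SmoothMatrices.
Variables (R : realType) (n : nat) (M : manifold R n).

Definition smooth_mx_at (a b : nat) (g : M -> 'M[R]_(a, b)) (p : M) : Prop :=
  forall i j, smooth_fun_at (fun q => g q i j) p.

Lemma smooth_mxP (a b : nat) (U : set M) (g : M -> 'M[R]_(a, b)) : open U ->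
  smooth_mx U g <-> forall p, U p -> smooth_mx_at g p.
Proof.
by move=> oU; split=> sg => [p Up i j|i j]; [|apply/smooth_funP => // p Up; exact: sg];
  exact: (smooth_funP _ oU).1 (sg i j) p Up.
Qed.

Lemma smooth_mx_at_eq (a b : nat) (g h : M -> 'M[R]_(a, b)) p :
  {near p, g =1 h} -> smooth_mx_at g p -> smooth_mx_at h p.
Proof.
move=> gh sg i j; apply: smooth_fun_at_eq (sg i j).
by apply: filterS gh => q ->.
Qed.

Lemma smooth_mx_at_cst (a b : nat) (A : 'M[R]_(a, b)) p : smooth_mx_at (fun=> A) p.
Proof. by move=> i j; exact: smooth_fun_at_cst. Qed.

Lemma smooth_mx_at_tr (a b : nat) (g : M -> 'M[R]_(a, b)) p :
  smooth_mx_at g p -> smooth_mx_at (fun q => (g q)^T) p.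
Proof. by move=> sg i j; under eq_fun do rewrite mxE; exact: sg. Qed.

Lemma smooth_mx_at_mul (a b c : nat) (g : M -> 'M[R]_(a, b)) (h : M -> 'M[R]_(b, c)) p :
  smooth_mx_at g p -> smooth_mx_at h p -> smooth_mx_at (fun q => g q *m h q) p.
Proof.
move=> sg sh i j; under eq_fun do rewrite mxE.
by apply: smooth_fun_at_sum => k; exact: smooth_fun_atM.
Qed.

Lemma smooth_mx_at_row (a b c : nat) (g : M -> 'M[R]_(a, b)) (h : M -> 'M[R]_(a, c)) p :
  smooth_mx_at g p -> smooth_mx_at h p -> smooth_mx_at (fun q => row_mx (g q) (h q)) p.
Proof.
move=> sg sh i j; case: (split_ordP j) => {}j ->.
  by under eq_fun do rewrite row_mxEl; exact: sg.
by under eq_fun do rewrite row_mxEr; exact: sh.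
Qed.

Lemma smooth_mx_at_col (a b c : nat) (g : M -> 'M[R]_(a, c)) (h : M -> 'M[R]_(b, c)) p :
  smooth_mx_at g p -> smooth_mx_at h p -> smooth_mx_at (fun q => col_mx (g q) (h q)) p.
Proof.
move=> sg sh i j; case: (split_ordP i) => {}i ->.
  by under eq_fun do rewrite col_mxEu; exact: sg.
by under eq_fun do rewrite col_mxEd; exact: sh.
Qed.

Lemma smooth_fun_at_det (a : nat) (g : M -> 'M[R]_a) p :
  smooth_mx_at g p -> smooth_fun_at (fun q => \det (g q)) p.
Proof.
move=> sg; rewrite /determinant.
apply: smooth_fun_at_sum => s; apply: smooth_fun_atM; first exact: smooth_fun_at_cst.
by apply: smooth_fun_at_prod => i; exact: sg.
Qed.

Lemma smooth_mx_at_adj (a : nat) (g : M -> 'M[R]_a) p :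
  smooth_mx_at g p -> smooth_mx_at (fun q => \adj (g q)) p.
Proof.
move=> sg i j; under eq_fun do rewrite mxE /cofactor.
apply: smooth_fun_atM; first exact: smooth_fun_at_cst.
apply: smooth_fun_at_det => i' j'; under eq_fun do rewrite !mxE; exact: sg.
Qed.

End SmoothMatrices.

(** * Right inverses depending smoothly on the matrix *)

Section RightInverse.
Variable R : realType.

(* [det^-1 *: adj] rather than [invmx], whose case analysis is not smooth. *)
Definition right_inv (a b : nat) (A : 'M[R]_(a, b)) : 'M[R]_(b, a) :=
  A^T *m ((\det (A *m A^T))^-1 *: \adj (A *m A^T)).

(* [x A A^T = 0] gives [|x A|^2 = 0], so that [A A^T] is invertible. *)
Lemma gram_det_neq0 (a b : nat) (A : 'M[R]_(a, b)) :
  (forall x : 'rV_a, x *m A = 0 -> x = 0) -> \det (A *m A^T) != 0.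
Proof.
move=> injA; apply/det0P => -[x /eqP x0 xAA]; apply: x0; apply: injA.
have : (x *m A) *m (x *m A)^T = 0 by rewrite trmx_mul mulmxA -(mulmxA x) xAA mul0mx.
move=> /matrixP/(_ 0 0); rewrite !mxE => /eqP; rewrite psumr_eq0; last first.
  by move=> i _; rewrite !mxE -expr2 sqr_ge0.
move=> /allP x0; apply/rowP => i; rewrite [RHS]mxE.
have /= := x0 i (mem_index_enum i); rewrite [X in _ * X]mxE -expr2 sqrf_eq0.
by move/eqP.
Qed.

Lemma mulmx_right_inv (a b : nat) (A : 'M[R]_(a, b)) :
  (forall x : 'rV_a, x *m A = 0 -> x = 0) -> A *m right_inv A = 1%:M.
Proof.
move=> /gram_det_neq0 d0; rewrite /right_inv mulmxA -scalemxAr mul_mx_adj.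
by rewrite scale_scalar_mx mulVf.
Qed.

(** Independence of the rows at [p] alone makes the Gram determinant nonzero at [p], and dividing by
    it is then smooth at [p]. *)
Lemma smooth_right_inv (n a b : nat) (M : manifold R n) (g : M -> 'M[R]_(a, b)) p :
  (forall x : 'rV_a, x *m g p = 0 -> x = 0) -> smooth_mx_at g p ->
  smooth_mx_at (fun q => right_inv (g q)) p.
Proof.
move=> /gram_det_neq0 d0 sg; have sgg := smooth_mx_at_mul sg (smooth_mx_at_tr sg).
apply: smooth_mx_at_mul; first exact: smooth_mx_at_tr.
move=> i j; under eq_fun do rewrite mxE.
apply: smooth_fun_atM; last exact: smooth_mx_at_adj.
exact/smooth_fun_atV/smooth_fun_at_det.
Qed.

End RightInverse.

Lemma inj_surj_bijective (A B : Type) (f : A -> B) :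
  injective f -> (forall y, exists x, f x = y) -> bijective f.
Proof. by move=> fI /choice[g gK]; exists g => // x; exact: fI. Qed.

Lemma linear_inj (R : realType) (U W : lmodType R) (f : {linear U -> W}) u :
  injective f -> f u = 0 -> u = 0.
Proof. by move=> fI fu; apply: fI; rewrite linear0. Qed.

Lemma bijective_surj (A B : Type) (f : A -> B) y : bijective f -> exists x, f x = y.
Proof. by case=> g _ gK; exists (g y). Qed.

(** * Matrices of bundle maps: localization, gluing and composition *)

Section SmoothBundleMaps.
Variables (R : realType) (n : nat) (M : manifold R n).
Implicit Types F G H : M -> lmodType R.

Definition smooth_matrix_at F G (k l : nat) (Phi : forall p, {linear F p -> G p})
    (s : trivialization F k) (t : trivialization G l) (p : M) : Prop :=
  exists g : M -> 'M[R]_(k, l), smooth_mx_at g p /\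
    \forall q \near p, forall u, tcoord t q (Phi q u) = tcoord s q u *m g q.

Lemma smooth_matrix_at_of F G (k l : nat) (Phi : forall p, {linear F p -> G p})
    (s : trivialization F k) (t : trivialization G l) p :
  open (tdom s) -> open (tdom t) -> tdom s p -> tdom t p ->
  smooth_matrix Phi s t -> smooth_matrix_at Phi s t p.
Proof.
move=> os ot sp tp [g [sg gE]]; have ost := openI os ot.
exists g; split; first exact: (smooth_mxP _ ost).1 sg p (conj sp tp).
apply: filterS (open_nbhs_nbhs (conj ost (conj sp tp))) => q [sq tq] u.
exact: gE.
Qed.

(** Since [tcoord s q] is onto, at most one matrix represents [Phi] at [q]. The pointwise choice by
    [xget] therefore coincides, near each point, with the smooth matrix given there. *)
Lemma smooth_matrix_local F G (k l : nat) (Phi : forall p, {linear F p -> G p})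
    (s : trivialization F k) (t : trivialization G l) :
  open (tdom s) -> open (tdom t) ->
  (forall p, tdom s p -> bijective (tcoord s p)) ->
  (forall p, tdom s p -> tdom t p -> smooth_matrix_at Phi s t p) ->
  smooth_matrix Phi s t.
Proof.
move=> os ot bs sPhi; have ost := openI os ot.
pose mat p (A : 'M[R]_(k, l)) := forall u, tcoord t p (Phi p u) = tcoord s p u *m A.
have mat_uniq p A B : tdom s p -> mat p A -> mat p B -> A = B.
  move=> sp hA hB; apply/row_matrixP => i; rewrite !rowE.
  by have [u <-] := bijective_surj (delta_mx 0 i) (bs p sp); rewrite -hA -hB.
have matP p : tdom s p -> tdom t p -> mat p (xget 0 (mat p)).
  move=> sp tp; apply: (@xgetPex _ _ (mat p)).
  by have [g [_ /nbhs_singleton gp]] := sPhi p sp tp; exists (g p).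
exists (fun p => xget 0 (mat p)); split=> [|p sp tp]; last exact: matP.
apply/smooth_mxP => // p [sp tp]; have [g [sg ng]] := sPhi p sp tp.
apply: smooth_mx_at_eq sg.
apply: filterS2 ng (open_nbhs_nbhs (conj ost (conj sp tp))) => q gq [sq tq].
exact: (mat_uniq q _ _ sq gq (matP q sq tq)).
Qed.

Lemma smooth_matrix_at_comp F G H (k l m : nat) (Phi : forall p, {linear F p -> G p})
    (Psi : forall p, {linear G p -> H p}) (Xi : forall p, {linear F p -> H p})
    (s : trivialization F k) (t : trivialization G l) (r : trivialization H m) p :
  (forall q u, Xi q u = Psi q (Phi q u)) ->
  smooth_matrix_at Phi s t p -> smooth_matrix_at Psi t r p -> smooth_matrix_at Xi s r p.
Proof.
move=> XiE [g [sg ng]] [h [sh nh]]; exists (fun q => g q *m h q).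
split; first exact: smooth_mx_at_mul.
by apply: filterS2 ng nh => q gq hq u; rewrite XiE hq gq mulmxA.
Qed.

End SmoothBundleMaps.

(** * Tangent vectors in arbitrary charts *)

Section TangentCoordinates.
Variable R : realType.

Lemma chart_atP (n : nat) (M : manifold R n) (p : M) :
  atlas M (chart_at p) /\ cdom (chart_at p) p.
Proof. by rewrite /chart_at; case: cid. Qed.

(** Both sides are [w] times the Jacobian of [f] from [chart_at p] to [d], factored through
    [chart_at (f p)] on the left and through [c] on the right. *)
Lemma tangent_triv_map (n n' : nat) (M : manifold R n) (N : manifold R n')
    (f : M -> N) p c d (w : tangent p) :
  atlas M c -> atlas N d -> cdom c p -> cdom d (f p) -> smooth_map_at f p ->
  tcoord (tangent_triv d) (f p) (tangent_map f p w) =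
    tcoord (tangent_triv c) p w *m 'J (chart_expr c d f) (c p).
Proof.
move=> Mc Nd cp dfp sf; have [cf _] := sf.
have [Ma ap] := chart_atP p; have [Nb bfp] := chart_atP (f p).
have [hc hd] := (atlas_is_chart Mc, atlas_is_chart Nd).
have [ha hb] := (atlas_is_chart Ma, atlas_is_chart Nb).
apply: etrans (esym (mulmxA w
  ('J (chart_expr (chart_at p) (chart_at (f p)) f) (chart_at p p))
  ('J (chart_expr (chart_at (f p)) d id) (chart_at (f p) (f p))))) _.
apply: etrans (mulmxA w ('J (chart_expr (chart_at p) c id) (chart_at p p))
  ('J (chart_expr c d f) (c p))).
congr mulmx; transitivity ('J (chart_expr (chart_at p) d f) (chart_at p p)).
  apply/esym/(jacobian_chart_comp (g := id) ha hb ap bfp cf).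
    exact: differentiable_chart_expr.
  exact/differentiable_chart_expr/smooth_map_at_id.
apply/(jacobian_chart_comp (f := id) ha hc ap cp).
- by move=> A.
- exact/differentiable_chart_expr/smooth_map_at_id.
- exact: differentiable_chart_expr.
Qed.

Variables (n : nat) (M : manifold R n).

Lemma tangent_triv_change (p : M) c d (w : tangent p) :
  atlas M c -> atlas M d -> cdom c p -> cdom d p ->
  tcoord (tangent_triv d) p w =
    tcoord (tangent_triv c) p w *m 'J (chart_expr c d id) (c p).
Proof.
move=> Mc Md cp dp; have [Ma ap] := chart_atP p.
have [ha hc] := (atlas_is_chart Ma, atlas_is_chart Mc).
rewrite -[RHS]mulmxA; congr mulmx.
apply/(jacobian_chart_comp (f := id) (g := id) ha hc ap cp).
- by move=> A.
- exact/differentiable_chart_expr/smooth_map_at_id.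
- exact/differentiable_chart_expr/smooth_map_at_id.
Qed.

Lemma jacobian_transitionK (p : M) c d : atlas M c -> atlas M d -> cdom c p -> cdom d p ->
  'J (chart_expr c d id) (c p) *m 'J (chart_expr d c id) (d p) = 1%:M.
Proof.
move=> Mc Md cp dp; have [hc hd] := (atlas_is_chart Mc, atlas_is_chart Md).
rewrite -(jacobian_chart_comp (f := id) (g := id) hc hd cp dp).
- by apply: jacobian_chart_id => //; near=> q.
- by move=> A.
- exact/differentiable_chart_expr/smooth_map_at_id.
- exact/differentiable_chart_expr/smooth_map_at_id.
Unshelve. all: by end_near. Qed.

Lemma tangent_triv_bij (p : M) c : atlas M c -> cdom c p ->
  bijective (tcoord (tangent_triv c) p).
Proof.
move=> Mc cp; have [Ma ap] := chart_atP p.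
exists (fun x => x *m 'J (chart_expr c (chart_at p) id) (c p)) => x.
  by apply: etrans (esym (mulmxA _ _ _)) _; rewrite jacobian_transitionK ?mulmx1.
by apply: etrans (esym (mulmxA _ _ _)) _; rewrite jacobian_transitionK ?mulmx1.
Qed.

End TangentCoordinates.

Lemma continuous_mx (T : topologicalType) (R : realType) (a b : nat)
    (f : T -> 'M[R]_(a, b)) (x : T) :
  (forall i j, {for x, continuous (fun y => f y i j)}) -> {for x, continuous f}.
Proof.
(* The [P i j] are neighbourhoods of the entries whose product lies in [A]. *)
move=> cf A [P nP PA].
have : \forall y \near x, forall ij : 'I_a * 'I_b, P ij.1 ij.2 (f y ij.1 ij.2).
  by apply: near_forall => -[i j]; exact: (cf i j _ (nP i j)).
by apply: filterS => y Py; apply: PA => i j; exact: (Py (i, j)).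
Qed.

Lemma continuous_coord (T : topologicalType) (R : realType) (a b : nat)
    (f : T -> 'M[R]_(a, b)) (x : T) i j :
  {for x, continuous f} -> {for x, continuous (fun y => f y i j)}.
Proof.
move=> cf; apply: (@continuous_comp _ _ _ f (fun A : 'M[R]_(a, b) => A i j)) => //.
exact: coord_continuous.
Qed.

(** * Fibred charts *)

Section FibredCoordinates.
Variable R : realType.

(** [prod_manifold] is only a premanifold, so its charts do not come with [is_chart]; this supplies
    it for the target of local trivializations. *)
Lemma prod_is_chart (T T' : topologicalType) (n n' : nat) (c : chart R T n)
    (c' : chart R T' n') : is_chart c -> is_chart c' -> is_chart (prod_chart c c').
Proof.
move=> [oc oi cK cc ci] [oc' oi' cK' cc' ci'].
have imE : prod_chart c c' @` cdom (prod_chart c c') =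
    lsubmx @^-1` (c @` cdom c) `&` rsubmx @^-1` (c' @` cdom c').
  apply/seteqP; split=> [_ [[p p'] [/= cp cp'] <-]|x [[p cp px] [p' cp' p'x]]].
    by split; rewrite /= ?row_mxKl ?row_mxKr; [exists p|exists p'].
  by exists (p, p') => //=; rewrite px p'x hsubmxK.
split=> [|||[p p'] [/= cp cp']|x].
- rewrite openE => -[p p'] [/= cp cp'].
  exists (cdom c, cdom c') => //.
  by split; apply: open_nbhs_nbhs.
- rewrite imE; apply: openI; apply: open_comp => // x _.
    exact: continuous_lsubmx.
  exact: continuous_rsubmx.
- by move=> [p p'] [/= cp cp']; rewrite row_mxKl row_mxKr cK // cK'.
- apply: continuous_mx => i j; case: (split_ordP j) => {}j ->.
    rewrite (_ : (fun y => _) = (fun q : T => c q i j) \o fst); last first.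
      by apply/funext => q /=; rewrite row_mxEl.
    apply: continuous_comp; first exact: cvg_fst.
    exact/continuous_coord/cc.
  rewrite (_ : (fun y => _) = (fun q : T' => c' q i j) \o snd); last first.
    by apply/funext => q /=; rewrite row_mxEr.
  apply: continuous_comp; first exact: cvg_snd.
  exact/continuous_coord/cc'.
- rewrite imE => -[cx c'x]; apply: cvg_pair; first exact: nbhs_filter.
    apply: (@continuous_comp _ _ _ (lsubmx : 'rV[R]_(n + n') -> 'rV[R]_n) (cinv c)).
      exact: continuous_lsubmx.
    exact: ci.
  apply: (@continuous_comp _ _ _ (rsubmx : 'rV[R]_(n + n') -> 'rV[R]_n') (cinv c')).
    exact: continuous_rsubmx.
  exact: ci'.
Qed.

End FibredCoordinates.

Section FibreBundleCharts.
Variables (R : realType) (n : nat) (M : manifold R n) (P : fibre_bundle M).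
Local Notation mu := (@fb_proj R n M P).
Local Notation f := (fb_fdim P).

Lemma atlas_open (n' : nat) (N : manifold R n') d : atlas N d -> open (cdom d).
Proof. by case/atlas_is_chart. Qed.

Lemma fb_proj_smooth_at p : smooth_map_at mu p.
Proof.
apply: (smooth_map_atP _ openT (@fb_proj_smooth _ _ _ P)) => //.
exact: atlas_open.
Qed.

(* The columns of [B] are the differentials of the base coordinates followed by
   those of the fibre coordinates. *)
Lemma fibred_chart (p0 : P) : exists c d (B : P -> 'M[R]_(fb_dim P, n + f))
    (H : P -> 'M[R]_(n + f, fb_dim P)),
  [/\ atlas M c, atlas P d, cdom d p0, cdom c (mu p0) &
   \forall p \near p0, [/\ smooth_mx_at B p, smooth_mx_at H p,
     B p *m H p = 1%:M, H p *m B p = 1%:M &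
     lsubmx (B p) = 'J (chart_expr d c mu) (d p)]].
Proof.
have [U [psi [chi [oU Up0 spsi schi [chiK psiK]]]]] := @fb_locally_trivial _ _ _ P (mu p0).
have [c [Mc cp0]] := chart_exists (mu p0).
have [d [Pd dp0]] := chart_exists p0.
have [y [Fy yp0]] := chart_exists (psi p0).
have [[hc hd] hy] := (atlas_is_chart Mc, atlas_is_chart Pd, atlas_is_chart Fy).
have hcy := prod_is_chart hc hy.
have cmu p : {for p, continuous mu} by have [] := fb_proj_smooth_at p.
have oV : open (mu @^-1` U) by apply: open_comp => // p _; exact: cmu.
have spsi_at p : U (mu p) -> smooth_map_at psi p.
  by move=> Up; apply: (smooth_map_atP _ oV spsi) => //; exact: atlas_open.
pose e p := (mu p, psi p).
pose cy := prod_chart c y.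
pose B p := 'J (chart_expr d cy e) (d p).
have nW : \forall p \near p0, [/\ U (mu p), cdom c (mu p), cdom d p & cdom y (psi p)].
  have nU : \forall p \near p0, U (mu p) by apply: (cmu p0); apply: open_nbhs_nbhs.
  have nc : \forall p \near p0, cdom c (mu p) by apply: (cmu p0); exact: near_cdom.
  have ny : \forall p \near p0, cdom y (psi p).
    by have [cpsi _] := spsi_at _ Up0; apply: cpsi; exact: near_cdom.
  have nd := near_cdom hd dp0.
  by near=> p; split; near: p.
have se p : U (mu p) -> cdom c (mu p) -> cdom d p -> cdom y (psi p) ->
    forall j, smooth_at (fun x => chart_expr d cy e x ord0 j) (d p).
  move=> Up cp dp yp j; case: (split_ordP j) => {}j ->.
    rewrite (_ : (fun x => _) = fun x => chart_expr d c mu x ord0 j).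
      exact/smooth_at_chart_expr/fb_proj_smooth_at.
    by apply/funext => x; rewrite [LHS]row_mxEl.
  rewrite (_ : (fun x => _) = fun x => chart_expr d y psi x ord0 j).
    exact/smooth_at_chart_expr/spsi_at.
  by apply/funext => x; rewrite [LHS]row_mxEr.
have de p : U (mu p) -> cdom c (mu p) -> cdom d p -> cdom y (psi p) ->
    differentiable (chart_expr d cy e) (d p).
  move=> Up cp dp yp; apply: differentiable_rowP => j.
  exact/smooth_at_differentiable/se.
have dchi p : U (mu p) -> cdom c (mu p) -> cdom d p -> cdom y (psi p) ->
    differentiable (chart_expr cy d chi) (cy (e p)).
  move=> Up cp dp yp; have [cchi sch] := schi; apply: differentiable_rowP => j.
  have oW : open ((U `*` setT) `&` chi @^-1` cdom d).
    rewrite openE => q [[Uq _] dq]; apply: filterI.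
      by exists (U, setT) => //; split; [exact: open_nbhs_nbhs|exact: filterT].
    by apply: (cchi q (conj Uq I)); exact: near_cdom.
  have Acy : atlas (prod_manifold M (fb_fibre P)) cy by exists c, y.
  have := sch cy d Acy Pd j.
  rewrite smooth_onP; last by rewrite -setIA; exact: chart_image_open.
  move=> h; apply/smooth_at_differentiable/h.
  by exists (e p) => //; split; [split=> //; split|rewrite /= chiK].
have ce p : U (mu p) -> {for p, continuous e}.
  by move=> Up; apply: cvg_pair; [exact: cmu|have [] := spsi_at p Up].
(* [K] is the Jacobian of the inverse trivialization [chi]. As no equality of dimensions is at hand,
   [B K = 1] (from [chi o e = id]) and [K B = 1] (from [e o chi = id]) are proved separately. *)
pose K p := 'J (chart_expr cy d chi) (cy (e p)).
have BK p : U (mu p) -> cdom c (mu p) -> cdom d p -> cdom y (psi p) ->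
    B p *m K p = 1%:M.
  move=> Up cp dp yp.
  transitivity ('J (chart_expr d d (chi \o e)) (d p)).
    apply/esym/(jacobian_chart_comp (d := cy) hd hcy dp) => //.
    - exact: ce.
    - exact: de.
    - exact: dchi.
  apply: jacobian_chart_id => //.
  by apply: filterS (open_nbhs_nbhs (conj oV Up)) => q Uq; exact: chiK.
have KB p : U (mu p) -> cdom c (mu p) -> cdom d p -> cdom y (psi p) ->
    K p *m B p = 1%:M.
  move=> Up cp dp yp; have [cchi _] := schi.
  have chie : chi (e p) = p by exact: chiK.
  have dchip : cdom d (chi (e p)) by rewrite chie.
  have dep : differentiable (chart_expr d cy e) (d (chi (e p))) by rewrite chie; exact: de.
  have := jacobian_chart_comp (e := cy) (g := e) (p := e p) hcy hd (conj cp yp) dchip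
    (cchi (e p) (conj Up I)) (dchi p Up cp dp yp) dep.
  rewrite chie => E; apply: etrans (esym E) _.
  apply: jacobian_chart_id => //.
  have : nbhs (e p) (U `*` setT).
    by exists (U, setT) => //; split; [exact: open_nbhs_nbhs|exact: filterT].
  apply: filterS => -[a b] [Ua _]; rewrite /e /=.
  by have [-> ->] := psiK a b Ua.
(* This witness equals [K], but as an expression in the entries of [B] its smoothness in [p] is
   immediate. The transposes turn a right inverse of [B^T] into a left inverse of [B]; the rows of
   [B^T] are independent because [K B = 1]. *)
exists c, d, B, (fun p => (right_inv (B p)^T)^T); split=> //.
apply: filterS nW => p [Up cp dp yp].
have BTinj (x : 'rV_(n + f)) : x *m (B p)^T = 0 -> x = 0.
  move=> xB; rewrite -[x]mulmx1 -[1%:M]trmx1 -(KB p) // trmx_mul mulmxA xB.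
  by rewrite mul0mx.
have sB : smooth_mx_at B p.
  by apply: smooth_jacobian_at => //; exact: se.
have HB : (right_inv (B p)^T)^T *m B p = 1%:M.
  by rewrite -[1%:M]trmx1 -(mulmx_right_inv BTinj) [RHS]trmx_mul trmxK.
split=> //.
- by apply: smooth_mx_at_tr; apply: smooth_right_inv => //; exact: smooth_mx_at_tr.
- suff -> : (right_inv (B p)^T)^T = K p by exact: BK.
  by rewrite -[LHS]mulmx1 -(BK p) // mulmxA HB mul1mx.
apply/matrixP => i j; rewrite mxE.
transitivity ('D_(delta_mx 0 i) (fun x => chart_expr d cy e x ord0 (lshift f j)) (d p) : R).
  by apply: jacobianE; exact: de.
transitivity ('D_(delta_mx 0 i) (fun x => chart_expr d c mu x ord0 j) (d p) : R).
  by congr ('D_ _ _ _); apply/funext => x; rewrite [LHS]row_mxEl.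
apply/esym/jacobianE; exact/differentiable_chart_expr/fb_proj_smooth_at.
Unshelve. all: by end_near. Qed.

End FibreBundleCharts.

(** * The prolongation bundle *)

Section VectorBundleFacts.
Variables (R : realType) (n k : nat) (M : manifold R n) (F : vector_bundle M k).

Lemma triv_open t : trivs F t -> open (tdom t).
Proof. by have [+ _ _ _] := vector_bundleP F; exact. Qed.

Lemma triv_bij t p : trivs F t -> tdom t p -> bijective (tcoord t p).
Proof. by have [_ + _ _] := vector_bundleP F; move=> h Ft; exact: h. Qed.

Lemma triv_exists p : exists t, trivs F t /\ tdom t p.
Proof. by have [_ _ + _] := vector_bundleP F; exact. Qed.

Lemma triv_transition s t : trivs F s -> trivs F t -> smooth_matrix (fun p => idfun) s t.
Proof. by have [_ _ _ +] := vector_bundleP F; exact. Qed.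

End VectorBundleFacts.

Section Pullback.
Variables (R : realType) (n : nat) (M : manifold R n) (P : fibre_bundle M).
Local Notation mu := (@fb_proj R n M P).

Lemma smooth_mx_at_pullback (a b : nat) (g : M -> 'M[R]_(a, b)) p :
  smooth_mx_at g (mu p) -> smooth_mx_at (g \o mu) p.
Proof.
move=> sg i j; apply: (smooth_fun_at_comp (g := fun q => g q i j)) (sg i j).
exact: fb_proj_smooth_at.
Qed.

Lemma near_pullback (Q : M -> Prop) p :
  (\forall q \near mu p, Q q) -> \forall q \near p, Q (mu q).
Proof. by have [+ _] := fb_proj_smooth_at p; apply. Qed.

Lemma open_pullback (U : set M) : open U -> open (mu @^-1` U).
Proof.
by move=> oU; apply: open_comp => // p _; have [] := fb_proj_smooth_at p.
Qed.

End Pullback.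

Section ProlongationBundle.
Variables (R : realType) (n : nat) (M : manifold R n) (k : nat).
Variables (F : vector_bundle M k) (rho : forall m, {linear F m -> tangent m}).
Hypothesis rho_smooth : smooth_hom (B := tangent_bundle M) rho.
Variable P : fibre_bundle M.
Local Notation mu := (@fb_proj R n M P).
Local Notation LP := (prolongation rho P).
Local Notation pfst := (prolongation_fst (P := P) rho).
Local Notation psnd := (prolongation_snd (P := P) rho).

Lemma prolongation_eq0 s d p (u : LP p) : trivs F s -> atlas P d ->
  tdom s (mu p) -> cdom d p -> tcoord s (mu p) (pfst p u) = 0 ->
  tcoord (tangent_triv d) p (psnd p u) = 0 -> u = 0.
Proof.
move=> Fs Pd sp dp s0 d0; apply: val_inj.
have u1 : (\val u).1 = 0 by apply: linear_inj s0; exact/bij_inj/triv_bij.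
have u2 : (\val u).2 = 0 by apply: linear_inj d0; exact/bij_inj/tangent_triv_bij.
by rewrite [LHS]surjective_pairing u1 u2.
Qed.

(** Serves twice: with [Phi] the identity it gives the transitions of the prolongation, and with
    [Phi] equal to [prolongation_I] the smoothness of that map. *)
Lemma smooth_matrix_prolongation (A : P -> lmodType R) (a : nat)
    (r : trivialization A a) (t : trivialization LP (k + fb_fdim P))
    (Phi : forall p, {linear A p -> LP p}) (Phi1 : forall p, {linear A p -> F (mu p)})
    (Phi2 : forall p, {linear A p -> tangent p}) :
  open (tdom r) -> (forall p, tdom r p -> bijective (tcoord r p)) ->
  (forall p u, Phi1 p u = pfst p (Phi p u)) ->
  (forall p u, Phi2 p u = psnd p (Phi p u)) ->
  (forall p, tdom r p -> exists s, [/\ trivs F s, tdom s (mu p) &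
     smooth_matrix_at Phi1 r (pullback_triv P s) p]) ->
  (forall d p, tdom r p -> atlas P d -> cdom d p ->
     smooth_matrix_at Phi2 r (tangent_triv d) p) ->
  prolongation_triv t -> smooth_matrix Phi r t.
Proof.
move=> or br Phi1E Phi2E sPhi1 sPhi2 [ot bt tfst tsnd].
apply: smooth_matrix_local => // p rp tp.
have [s [Fs sp [g1 [sg1 g1E]]]] := sPhi1 p rp.
have [d [Pd dp]] := chart_exists p.
have [g2 [sg2 g2E]] := sPhi2 d p rp Pd dp.
have oP : open (tdom (pullback_triv P s)) by apply: open_pullback; exact: triv_open Fs.
have od : open (tdom (tangent_triv d)) by exact: atlas_open Pd.
have Pd' : trivs (tangent_bundle P) (tangent_triv d) by exists d.
have [h1 [sh1 h1E]] := smooth_matrix_at_of ot oP tp sp (tfst s Fs).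
have [h2 [sh2 h2E]] := smooth_matrix_at_of ot od tp dp (tsnd _ Pd').
pose h q := row_mx (h1 q) (h2 q).
(* [x] is the coordinate vector of some [u], and [x *m h q = 0] says that both components of [u]
   vanish. *)
have hinj : \forall q \near p, forall x : 'rV_(k + fb_fdim P), x *m h q = 0 -> x = 0.
  have nt := open_nbhs_nbhs (conj ot tp); have nd := open_nbhs_nbhs (conj od dp).
  have ns := open_nbhs_nbhs (conj oP sp).
  apply: filterS3 nt nd (filterI ns (filterI h1E h2E)) => q tq dq [sq [h1q h2q]] x.
  have [u <-] := bijective_surj x (bt q tq).
  rewrite mul_mx_row -h1q -h2q -[0]row_mx0 => /eq_row_mx[u1 u2].
  by rewrite (prolongation_eq0 Fs Pd sq dq u1 u2) linear0.
exists (fun q => row_mx (g1 q) (g2 q) *m right_inv (h q)); split.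
  apply: smooth_mx_at_mul; first exact: smooth_mx_at_row.
  by apply: smooth_right_inv; [exact: nbhs_singleton hinj|exact: smooth_mx_at_row].
apply: filterS3 (filterI g1E g2E) (filterI h1E h2E) hinj => q [g1q g2q] [h1q h2q] hq u.
rewrite mulmxA mul_mx_row -g1q -g2q Phi1E Phi2E.
(* The [t]-coordinates of [Phi u] times [h] are the coordinates of its two components; the right
   inverse cancels [h]. *)
rewrite -[LHS]mulmx1 -(mulmx_right_inv hq) mulmxA mul_mx_row -h1q -h2q.
by [].
Qed.

Lemma prolongation_triv_exists p0 :
  exists t, prolongation_triv (rho := rho) (P := P) t /\ tdom t p0.
Proof.
have [s [Fs sp0]] := triv_exists F (mu p0).
have [c [d [B [H [Mc Pd dp0 cp0 nBH]]]]] := fibred_chart p0.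
have [hc hd] := (atlas_is_chart Mc, atlas_is_chart Pd).
have Mc' : trivs (tangent_bundle M) (tangent_triv c) by exists c.
have Pd' : trivs (tangent_bundle P) (tangent_triv d) by exists d.
pose Q p := [/\ smooth_mx_at B p, smooth_mx_at H p, B p *m H p = 1%:M,
  H p *m B p = 1%:M & lsubmx (B p) = 'J (chart_expr d c mu) (d p)].
pose good := [set p | [/\ Q p, cdom d p, cdom c (mu p) & tdom s (mu p)]].
have nm (U : set M) : open U -> U (mu p0) -> \forall p \near p0, U (mu p).
  by move=> oU Up; apply: near_pullback; apply: open_nbhs_nbhs.
have : \forall p \near p0, good p.
  have nd := near_cdom hd dp0; have nc := nm _ (atlas_open Mc) cp0.
  have ns := nm _ (triv_open Fs) sp0.
  by apply: filterS3 nd nc (filterI ns nBH) => p dp cp [sp Qp].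
rewrite {1}/prop_near1 nbhsE => -[W [oW Wp0] Wgood].
pose co p (u : LP p) : 'rV_(k + fb_fdim P) := row_mx (tcoord s (mu p) (pfst p u))
   (tcoord (tangent_triv d) p (psnd p u) *m rsubmx (B p)).
have co_lin p : linear (co p).
  move=> a u v; rewrite /co scale_row_mx add_row_mx.
  by rewrite !(linearP (pfst p)) !(linearP (psnd p)) !linearP /= mulmxDl -scalemxAl.
pose coL p : {linear LP p -> 'rV_(k + fb_fdim P)} :=
  HB.pack_for {linear LP p -> 'rV_(k + fb_fdim P)} (co p)
    (GRing.isLinear.Build R (LP p) 'rV_(k + fb_fdim P) _ (co p) (co_lin p)).
pose t : trivialization LP (k + fb_fdim P) := Triv W coL.
have anchorE p (u : LP p) : good p ->
    tcoord (tangent_triv c) (mu p) (rho (mu p) (pfst p u)) =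
    tcoord (tangent_triv d) p (psnd p u) *m lsubmx (B p).
  move=> [[_ _ _ _ ->] dp cp _].
  have -> : rho (mu p) (pfst p u) = tangent_map mu p (psnd p u) by exact: (sm_valP u).
  exact/tangent_triv_map/fb_proj_smooth_at.
(* [H] rebuilds the tangent vector from its base component, which is [rho z], and its fibre
   component. Hence [co] determines it, which gives both injectivity and the matrix of [psnd]. *)
have sndE p (u : LP p) : good p -> tcoord (tangent_triv d) p (psnd p u) =
    row_mx (tcoord (tangent_triv c) (mu p) (rho (mu p) (pfst p u)))
           (tcoord (tangent_triv d) p (psnd p u) *m rsubmx (B p)) *m H p.
  move=> gp; rewrite anchorE // -mul_mx_row hsubmxK -mulmxA.
  by have [[_ _ -> _ _] _ _ _] := gp; rewrite mulmx1.
have bt p : W p -> bijective (co p).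
  move=> /Wgood gp; have [[_ _ _ HB _] dp cp sp] := gp.
  apply: inj_surj_bijective.
    apply: (@raddf_inj _ _ (coL p)) => u; rewrite -[0]row_mx0 => /eq_row_mx[u1 u2].
    have fst0 : pfst p u = 0 by apply: linear_inj u1; exact/bij_inj/(triv_bij Fs).
    apply: (prolongation_eq0 Fs Pd sp dp u1).
    by rewrite sndE // u2 fst0 !linear0 row_mx0 mul0mx.
  move=> x; have [z zx] := bijective_surj (lsubmx x) (triv_bij Fs sp).
  (* The base component prescribed for the tangent vector is [rho z], as membership in the
     prolongation demands; the fibre component is free and is read off [x]. *)
  pose y := row_mx (tcoord (tangent_triv c) (mu p) (rho (mu p) z)) (rsubmx x).
  have [w wE] := bijective_surj (y *m H p) (tangent_triv_bij Pd dp).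
  have wB : tcoord (tangent_triv d) p w *m B p = y by rewrite wE -mulmxA HB mulmx1.
  have zw : in_prolongation rho (z, w).
    apply: (bij_inj (tangent_triv_bij Mc cp)).
    apply/esym; apply: etrans (tangent_triv_map w Pd Mc dp cp (fb_proj_smooth_at p)) _.
    have [[_ _ _ _ <-] _ _ _] := gp.
    by rewrite mulmx_lsub wB row_mxKl.
  exists (mk_sub (S := Submodule (@in_prolongation0 _ _ _ _ _ rho P p)
                         (@in_prolongationZD _ _ _ _ _ rho P p)) zw).
  rewrite /co -[RHS]hsubmxK; congr row_mx; first exact: zx.
  by apply: etrans (mulmx_rsub _ _) _; rewrite wB row_mxKr.
exists t; split=> //; split=> //.
- move=> s' Fs'; apply: smooth_matrix_local => //.
    by apply: open_pullback; exact: triv_open Fs'.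
  move=> p Wp s'p; have [_ _ _ sp] := Wgood p Wp.
  have [g [sg gE]] := smooth_matrix_at_of (triv_open Fs) (triv_open Fs') sp s'p
    (triv_transition Fs Fs').
  (* The component in [F] depends on the first [k] coordinates only, hence the zero rows. *)
  exists (fun q => col_mx (g (mu q)) 0); split.
    by apply: smooth_mx_at_col; [exact: smooth_mx_at_pullback|exact: smooth_mx_at_cst].
  apply: filterS (near_pullback gE) => q gq u.
  by rewrite mul_row_col mulmx0 addr0; exact: gq.
- move=> _ [d' Pd'' ->]; apply: smooth_matrix_local => //; first exact: atlas_open.
  move=> p Wp d'p; have [[_ sH _ _ _] dp cp sp] := Wgood p Wp.
  have [r [sr rE]] := smooth_matrix_at_of (t := tangent_triv c) (triv_open Fs)
    (atlas_open Mc) sp cp (rho_smooth Fs Mc').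
  (* From left to right: replace the coordinates of [z] by those of [rho z] and keep the fibre
     component, pass by [H] to the chart [d], then change to [d']. *)
  exists (fun q => block_mx (r (mu q)) 0 0 1%:M *m H q *m 'J (chart_expr d d' id) (d q)).
  split.
    apply: smooth_mx_at_mul.
      apply: smooth_mx_at_mul => //; apply: smooth_mx_at_col; apply: smooth_mx_at_row.
      - exact: smooth_mx_at_pullback.
      - exact: smooth_mx_at_cst.
      - exact: smooth_mx_at_cst.
      - exact: smooth_mx_at_cst.
    by apply: smooth_jacobian_at => // j; exact: smooth_at_transition.
  have nd' : \forall q \near p, cdom d' q by apply: near_cdom => //; exact: atlas_is_chart.
  apply: filterS3 (open_nbhs_nbhs (conj oW Wp)) nd' (near_pullback rE) => q Wq d'q rq u.
  have gq := Wgood q Wq; have [_ dq _ _] := gq.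
  apply: etrans (tangent_triv_change _ Pd Pd'' dq d'q) _.
  rewrite (sndE q u gq) !mulmxA; congr (_ *m _ *m _).
  by rewrite mul_row_block !mulmx0 mulmx1 addr0 add0r rq.
Qed.

Lemma prolongation_is_vector_bundle : is_vector_bundle LP.
Proof.
split=> [t [] //|t [] //|p|s t /= hs ht]; first exact: prolongation_triv_exists.
have [os bs sfst ssnd] := hs.
(* The two components of the identity are the projections, smooth in [s] because [s] satisfies
   [prolongation_triv]. *)
apply: (smooth_matrix_prolongation (Phi1 := pfst) (Phi2 := psnd)) => //.
  move=> p sp; have [r [Fr rp]] := triv_exists F (mu p); exists r; split=> //.
  apply: smooth_matrix_at_of (sfst r Fr) => //.
  by apply: open_pullback; exact: triv_open Fr.
move=> d p sp Pd dp; apply: smooth_matrix_at_of => //; first exact: atlas_open.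
by apply: ssnd; exists d.
Qed.

End ProlongationBundle.

(** * The exact sequence *)

Section BidualMaps.
Variables (R : realType) (V : lmodType R) (E : affine_space V).

(** A constant function has zero linear part, as comparing its values at [a] and at a translate of
    [a] shows. *)
Lemma canon_j_bi (v : V) : canon_j (canon_bi E v) = 0.
Proof.
have [a] := point_inhabited E; apply: (addrI (\val (aff_one E) a)).
by rewrite addr0; exact: (esym (linear_partE (aff_one E) a v)).
Qed.

Lemma canon_j_i (a : E) : canon_j (canon_i a) = 1.
Proof. by []. Qed.

End BidualMaps.

Section BidualBundleMaps.
Variables (R : realType) (n : nat) (M : manifold R n) (k : nat).
Variables (V : vector_bundle M k) (E : affine_bundle V).

(** In coordinates, [V] sits in the bidual as the vectors whose first entry, the value of [j], is
    zero. Injectivity of [canon_bi], the kernel of [j] and smoothness are all read off this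
    formula. *)
Lemma bidual_coord_bi (e : affine_trivialization E k) p (v : V p) :
  bidual_coord e (canon_bi (E p) v) = row_mx 0 (alin e p v).
Proof.
rewrite /bidual_coord canon_j_bi; congr row_mx; first exact: raddf0.
apply/rowP => j; rewrite mxE /=.
have [a] := point_inhabited (E p); apply: (addrI (\val (acoord_fun e p j) a)).
apply: etrans (esym (linear_partE _ a v)) _.
by rewrite /= acoordD mxE.
Qed.

Lemma canon_bi_inj p : injective (canon_bi (E p)).
Proof.
apply: raddf_inj => v v0; have [e [Ee ep]] := atriv_cover E p.
have := bidual_coord_bi e v; rewrite v0 linear0 -[LHS]row_mx0 => /eq_row_mx[_ /esym].
exact/linear_inj/bij_inj/atriv_bij.
Qed.

Lemma canon_j_eq0 p (z : bidual (E p)) :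
  canon_j z = 0 -> exists v : V p, canon_bi (E p) v = z.
Proof.
move=> z0; have [e [Ee ep]] := atriv_cover E p.
have [v vE] := bijective_surj (\row_j \val z (acoord_fun e p j)) (atriv_bij Ee ep).
exists v; apply: (bij_inj (bidual_coord_bij Ee ep)).
by rewrite bidual_coord_bi vE /bidual_coord z0 raddf0.
Qed.

Lemma canon_bi_smooth : smooth_hom (A := V) (B := bidual_bundle E)
  (fun p => canon_bi (E p)).
Proof.
move=> t _ Vt [e Ee ->]; have [g [sg gE]] := atriv_model Ee Vt.
have ote : open (tdom t `&` adom e).
  by apply: openI; [exact: triv_open Vt|exact: atriv_open Ee].
(* The zero column belongs to the coordinate [j]; [g] compares [t] with the linear part of [e]. *)
exists (fun p => row_mx 0 (g p)); split=> [|p tp ep v].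
  apply/smooth_mxP => // p tep; apply: smooth_mx_at_row; first exact: smooth_mx_at_cst.
  exact: (smooth_mxP _ ote).1 sg p tep.
by rewrite mul_mx_row mulmx0 /= bidual_coord_bi; congr row_mx; exact: gE.
Qed.

(** A composite of smooth maps. No single trivialization of the bidual need cover the overlap, so
    one is chosen near each point and the matrices are glued. *)
Lemma linear_anchor_smooth (L : affine_lie_algebroid E) :
  smooth_hom (A := V) (B := tangent_bundle M) (linear_anchor L).
Proof.
move=> s _ Vs [c Mc ->]; have tc : trivs (tangent_bundle M) (tangent_triv c) by exists c.
apply: smooth_matrix_local.
- exact: triv_open Vs.
- exact: atlas_open.
- by move=> p; exact: (triv_bij Vs).
move=> p sp cp; have [t [Et tp]] := triv_exists (bidual_bundle E) p.
apply: (smooth_matrix_at_comp (Phi := fun q => canon_bi (E q)) (Psi := anchor L)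
  (t := t)) => //.
  exact: (smooth_matrix_at_of (triv_open Vs) (triv_open Et) sp tp
    (canon_bi_smooth Vs Et)).
exact: (smooth_matrix_at_of (t := tangent_triv c) (triv_open Et) (atlas_open Mc) tp cp
  (anchor_smooth L Et tc)).
Qed.

Lemma trivial_line_is_vector_bundle : is_vector_bundle (trivial_line_bundle M).
Proof.
split=> [_ -> /=|_ -> p _ /=|p|_ _ -> -> /=]; first exact: openT.
- exists (fun x : 'rV_1 => x ord0 ord0) => x; first by rewrite mxE eqxx mulr1n.
  by rewrite [RHS]mx11_scalar.
- by exists (Triv setT (@line_coord R n M)).
exists (fun=> 1%:M); split=> [|p _ _ u]; last by rewrite mulmx1.
by apply/smooth_mxP => [|p _]; [exact/openI/openT/openT|exact: smooth_mx_at_cst].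
Qed.

End BidualBundleMaps.

Section ProlongationSequence.
Variables (R : realType) (n : nat) (M : manifold R n) (k : nat).
Variables (V : vector_bundle M k) (E : affine_bundle V).
Variables (L : affine_lie_algebroid E) (P : fibre_bundle M).
Local Notation mu := (@fb_proj R n M P).

(** In adapted coordinates a lift has base component [w] and fibre component zero. *)
Lemma tangent_map_fb_proj_surj (p : P) (w : tangent (mu p)) :
  exists W, tangent_map mu p W = w.
Proof.
have [c [d [B [H [Mc Pd dp cp nBH]]]]] := fibred_chart p.
have [_ _ _ HB BE] := nbhs_singleton nBH.
pose x := tcoord (tangent_triv c) (mu p) w.
have [W WE] := bijective_surj (row_mx x 0 *m H p) (tangent_triv_bij Pd dp).
exists W; apply: (bij_inj (tangent_triv_bij Mc cp)).
apply: etrans (tangent_triv_map W Pd Mc dp cp (fb_proj_smooth_at p)) _.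
by rewrite WE -BE mulmx_lsub -mulmxA HB mulmx1 row_mxKl.
Qed.

Lemma prolongation_I_smooth :
  smooth_hom (A := prolongation_V L P) (B := prolongation_bidual L P)
    (fun p => prolongation_I L p).
Proof.
move=> s t hs ht; have [os bs sfst ssnd] := hs.
(* The first component of [I]. It is smooth as the projection to [V] followed by the pullback of
   [canon_bi] along [mu]; the second component is the projection itself. *)
pose Phi1 p : {linear prolongation_V L P p -> bidual_bundle E (mu p)} :=
  canon_bi (E (mu p)) \o prolongation_fst (linear_anchor L) p.
apply: (smooth_matrix_prolongation (rho := anchor L) (Phi1 := Phi1)
  (Phi2 := prolongation_snd (P := P) (linear_anchor L))) => //.
  move=> p sp; have [t' [Et' t'p]] := triv_exists (bidual_bundle E) (mu p).
  have [r [Vr rp]] := triv_exists V (mu p).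
  have opr := @open_pullback _ _ _ P _ (triv_open Vr).
  exists t'; split=> //.
  have sfst_r := smooth_matrix_at_of (t := pullback_triv P r) os opr sp rp (sfst r Vr).
  have [g [sg gE]] := smooth_matrix_at_of (triv_open Vr) (triv_open Et') rp t'p
    (canon_bi_smooth Vr Et').
  have sbi : smooth_matrix_at (fun q => canon_bi (E (mu q)))
      (pullback_triv P r) (pullback_triv P t') p.
    exists (g \o mu); split; first exact: smooth_mx_at_pullback.
    exact: near_pullback gE.
  exact: smooth_matrix_at_comp sfst_r sbi.
move=> d p sp Pd dp; apply: smooth_matrix_at_of => //; first exact: atlas_open.
by apply: ssnd; exists d.
Qed.

Lemma prolongation_J_smooth :
  smooth_hom (A := prolongation_bidual L P) (B := trivial_line_bundle P)
    (fun p => prolongation_J L p).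
Proof.
move=> s _ hs ->; have [os bs sfst _] := hs.
apply: smooth_matrix_local => //; first exact: openT.
move=> p sp _; have [_ [[e Ee ->] ep]] := triv_exists (bidual_bundle E) (mu p).
have Et : trivs (bidual_bundle E) (bidual_triv e) by exists e.
have [g [sg gE]] := smooth_matrix_at_of
  (t := pullback_triv (F := bidual_bundle E) P (bidual_triv e)) os
  (@open_pullback _ _ _ P _ (triv_open Et))
  sp ep (sfst _ Et).
(* [canon_j] is the first coordinate of [bidual_triv e], so the matrix of [J] is the first column of
   that of the projection to the bidual. *)
exists (fun q => g q *m col_mx 1%:M 0); split.
  by apply: smooth_mx_at_mul => //; exact: smooth_mx_at_cst.
apply: filterS gE => q gq u; rewrite mulmxA -gq.
by apply/esym; apply: etrans (mul_row_col _ _ _ _) _; rewrite mulmx1 mulmx0 addr0.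
Qed.

End ProlongationSequence.

Theorem proposition5 (R : realType) (n k : nat) (M : manifold R n)
    (V : vector_bundle M k) (E : affine_bundle V) (L : affine_lie_algebroid E)
    (P : fibre_bundle M) :
  short_exact (A := prolongation_V L P) (B := prolongation_bidual L P)
    (C := trivial_line_bundle P)
    (fun p => prolongation_I L p) (fun p => prolongation_J L p).
Proof.
split.
- split; last exact: trivial_line_is_vector_bundle.
    exact/prolongation_is_vector_bundle/linear_anchor_smooth.
  exact/prolongation_is_vector_bundle/anchor_smooth.
- exact: prolongation_I_smooth.
- exact: prolongation_J_smooth.
move=> p; split=> [u u0|v|w].
- have u1 : canon_bi (E (fb_proj p)) (\val u).1 = 0 by exact: (congr1 (fst \o \val) u0).
  have u2 : (\val u).2 = 0 by exact: (congr1 (snd \o \val) u0).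
  apply: val_inj; rewrite [LHS]surjective_pairing u2.
  by rewrite (linear_inj (@canon_bi_inj _ _ _ _ _ _ _) u1).
- split=> [v0|[u <-]]; last exact: canon_j_bi.
  have [x xE] := canon_j_eq0 v0.
  (* The anchor of [V] at [x] is by definition the anchor at [canon_bi x], which is the bidual
     component of [v]; so [x] may keep the tangent vector of [v]. *)
  have xP : in_prolongation (P := P) (linear_anchor L) (x, (\val v).2).
    by apply: etrans (sm_valP v); congr (anchor L _ _).
  exists (mk_sub (S := Submodule (@in_prolongation0 _ _ _ _ _ (linear_anchor L) P p)
                         (@in_prolongationZD _ _ _ _ _ (linear_anchor L) P p)) xP).
  by apply: val_inj; rewrite [RHS]surjective_pairing; congr pair.
have [a] := point_inhabited (E (fb_proj p)).
(* Every point [a] of the affine fibre has [j (i a) = 1], so [z] has [j]-value [w]; [W] then lifts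
   the anchor of [z] to the total space. *)
pose z : bidual (E (fb_proj p)) := w *: canon_i a.
have [W WE] := tangent_map_fb_proj_surj (anchor L _ z).
have zW : in_prolongation (P := P) (anchor L) (z, W) by exact: esym WE.
exists (mk_sub (S := Submodule (@in_prolongation0 _ _ _ _ _ (anchor L) P p)
                       (@in_prolongationZD _ _ _ _ _ (anchor L) P p)) zW).
suff jz : canon_j z = w by exact: jz.
by rewrite /z linearZ /= canon_j_i; exact: mulr1.
Qed.
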